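(* Let $I\subset\mathbb{R}$ be a closed interval and let $\Phi:I\to\mathbb{R}$ be a smooth convex function such that $(u,v)\mapsto\Phi''(u)v^2$ is non-negative and convex on $I\times I$. Let $(\Omega,\mathcal{F},\mu)=(\Omega_1\times\cdots\times\Omega_n,\ \mathcal{F}_1\otimes\cdots\otimes\mathcal{F}_n,\ \mu_1\otimes\cdots\otimes\mu_n)$ be a product probability space. Then for every measurable function $f:\Omega\to I$, $$\mathrm{Ent}^\Phi_{\mu_1\otimes\cdots\otimes\mu_n}(f)\le\int_\Omega\mathrm{Ent}^\Phi_{\mu_1}(f)\,d\mu+\cdots+\int_\Omega\mathrm{Ent}^\Phi_{\mu_n}(f)\,d\mu .$$
   Context: For a probability measure $\mu$ and a $\mu$-integrable $f$ with values in $I$, $\mathrm{Ent}^\Phi_\mu(f):=\int\Phi(f)\,d\mu-\Phi\big(\int f\,d\mu\big)\in[0,+\infty]$; the functional is only considered on integrable functions. On the product space, $\mathrm{Ent}^\Phi_{\mu_i}(f)$ denotes the function on $\Omega$ obtained by computing the $\Phi$-entropy with respect to $\mu_i$ of $f$ viewed as a function of its $i$-th coordinate, the other coordinates being fixed. *)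

(* Defs.v *)
From HB Require Import structures.
From mathcomp Require Import all_boot all_order all_algebra.
From mathcomp Require Import all_classical all_reals all_analysis.
Set Implicit Arguments.
Unset Strict Implicit.
Unset Printing Implicit Defensive.
Import Order.TTheory GRing.Theory Num.Theory.
Import numFieldNormedType.Exports.
Local Open Scope classical_set_scope.
Local Open Scope ring_scope.

(* A function on an interval I is represented by a function on R whose values
   outside I are irrelevant.  Smoothness on a closed interval is meant as
   continuity on I, endpoints included, together with the existence of all
   derivatives in the interior of I; no differentiability is required at the
   endpoints, so that u |-> u ln u is smooth on [0, +oo[.  At interior points
   derive1n depends only on the values in I. *)
Definition smooth_on (R : realType) (I : set R) (Phi : R -> R) : Prop :=
  {within I, continuous Phi} /\
  (forall (k : nat) (u : R), interior I u -> derivable (derive1n k Phi) u 1).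

(* The map (u, v) |-> Phi''(u) v^2 is non-negative and convex.  The variable u
   ranges over the interior of I, where Phi'' is defined by [smooth_on]; if
   Phi is smooth up to the endpoints, this is equivalent, by continuity of
   Phi'', to the same requirement for u in the whole of I (as soon as I is not
   reduced to a point). *)
Definition second_derivative_condition (R : realType) (I : set R)
    (Phi : R -> R) : Prop :=
  let F := fun z : R^o * R^o => derive1n 2 Phi z.1 * z.2 ^+ 2 in
  (forall z, (interior I `*` I) z -> 0 <= F z) /\
  @convex_function R (R^o * R^o)%type (interior I `*` I) F.

(* The dependent product of the T i, with the sigma-algebra generated by the
   coordinate projections. *)
Definition cylinders (n : nat) (d : 'I_n -> measure_display)
    (T : forall i, measurableType (d i)) : set (set (forall i, T i)) :=
  \bigcup_(i in [set: 'I_n])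
    preimage_set_system setT (fun x : forall i, T i => x i) measurable.

Definition prod_space (n : nat) (d : 'I_n -> measure_display)
    (T : forall i, measurableType (d i)) :=
  g_sigma_algebraType (@cylinders n d T).

(* mu is mu_0 \x ... \x mu_(n-1): measurable boxes generate the product
   sigma-algebra and are stable under intersection, so at most one probability
   measure satisfies this product rule. *)
Definition is_product_measure (R : realType) (n : nat)
    (d : 'I_n -> measure_display) (T : forall i, measurableType (d i))
    (mu_ : forall i, probability (T i) R)
    (mu : probability (prod_space T) R) : Prop :=
  forall A : (forall i, set (T i)), (forall i, measurable (A i)) ->
    mu [set x : prod_space T | forall i, A i (x i)] =
    (\prod_(i < n) mu_ i (A i))%E.

(* Meaningful when g is mu-integrable with values in an interval on which Phi
   is convex: the first integral then belongs to ]-oo, +oo]. *)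
Definition Phi_entropy (R : realType) (Phi : R -> R) (d : measure_display)
    (T : measurableType d) (mu : probability T R) (g : T -> R) : \bar R :=
  (\int[mu]_x (Phi (g x))%:E - (Phi (\int[mu]_x g x)%R)%:E)%E.

(* The entropy of f in its i-th coordinate, as a function on the product space.
   If f is integrable for the product measure, its i-th section through x is
   mu_i-integrable for almost every x; the values at the remaining points do
   not affect the integral of this function. *)
Definition coord_entropy (R : realType) (Phi : R -> R) (n : nat)
    (d : 'I_n -> measure_display) (T : forall i, measurableType (d i))
    (mu_ : forall i, probability (T i) R) (f : prod_space T -> R)
    (i : 'I_n) (x : prod_space T) : \bar R :=
  Phi_entropy Phi (mu_ i) (fun y : T i => f (@dfwith 'I_n (fun j => T j) x i y)).

(* Main.v *)
(* The convexity of (u, v) |-> Phi''(u) v^2 makes the Bregman divergence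
   D(u, w) = Phi u - Phi w - Phi'(w) (u - w) jointly convex.  The entropy in the
   k-th coordinate is the k-mean of D(f, E_k f), where E_k integrates out the
   k-th coordinate; as the E_j commute, Jensen's inequality for D says that the
   mean of the k-th entropy does not increase when f is replaced by E_j f, j != k.
   Integrating out the coordinates one after the other then gives a telescoping
   sum.  This settles functions with values in a compact interval contained in
   the interior of I.  A general f is truncated to such intervals: truncation
   decreases every coordinate entropy, since it decreases D, and the entropy of
   f itself is recovered in the limit by Fatou's lemma. *)
Require Import Defs.
From HB Require Import structures.
From mathcomp Require Import all_boot all_order all_algebra.
From mathcomp Require Import all_classical all_reals all_analysis.
From mathcomp Require Import measurable_realfun.
From mathcomp Require Import ring lra.
Import Order.TTheory GRing.Theory Num.Theory.
Import numFieldNormedType.Exports.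
Local Open Scope classical_set_scope.
Local Open Scope ring_scope.
Set Implicit Arguments.
Unset Strict Implicit.

(** * Real analysis: joint convexity of the Bregman divergence *)

(** Write F (u, v) = Phi''(u) v^2. The Hessian of D at (u, w) in the direction (e, d) equals F (u,
    e) minus the first-order Taylor polynomial of F at (w, d), evaluated at (u, e). Joint convexity
    of D is therefore the tangent inequality for F, and it is kept in tangent form, ready to be
    integrated. Two obstacles shape the truncation. Phi' may blow up at an endpoint of I, so in D(u,
    w) only u may be an endpoint; a mean that is an endpoint forces the function to be almost
    everywhere constant, with zero entropy. And Phi(f) is not assumed integrable: the sum computed
    for f bounds the entropies of all the truncations at once, so that, when it is finite, only
    lower semicontinuity on the left remains. There Fatou's lemma is applied to the non-negative
    function D(., c) for a fixed interior point c. It differs from Phi by an affine function, and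
    the integrals of the affine part converge by dominated convergence. *)

Section derive_rules.
Context {R : realType}.
Implicit Types (f g : R -> R) (t : R).

Lemma is_derive_funD f g t df dg : is_derive t 1 f df -> is_derive t 1 g dg ->
  is_derive t 1 (fun s => f s + g s) (df + dg).
Proof. by move=> ? ?; exact: is_deriveD. Qed.

Lemma is_derive_funN f t df : is_derive t 1 f df ->
  is_derive t 1 (fun s => - f s) (- df).
Proof. by move=> ?; exact: is_deriveN. Qed.

Lemma is_derive_funM f g t df dg : is_derive t 1 f df -> is_derive t 1 g dg ->
  is_derive t 1 (fun s => f s * g s) (f t * dg + g t * df).
Proof. by move=> ? ?; exact: is_deriveM. Qed.

Lemma is_derive_const (c t : R) : is_derive t 1 (fun=> c) 0.
Proof. exact: is_derive_cst. Qed.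

Lemma is_derive_line f (a b t df : R) : is_derive (a + t * b) 1 f df ->
  is_derive t 1 (fun s => f (a + s * b)) (df * b).
Proof.
move=> dfab; apply: (@is_derive1_comp _ f (fun s => a + s * b)) => //.
have := is_derive_funD (is_derive_cst a t 1)
  (is_derive_funM (is_derive_id t 1) (is_derive_cst b t 1)).
by move=> /is_derive_eq; apply; rewrite mulr0 !add0r mulr1.
Qed.

(** Two applications of the mean value theorem, to [f] and then to [f1]. The tangent inequalities
    for F and for D both reduce to this by restriction to a segment parametrized by [0, 1]. *)
Lemma convex_ge_tangent (f f1 f2 : R -> R) :
  (forall t, 0 <= t <= 1 -> is_derive t 1 f (f1 t)) ->
  (forall t, 0 <= t <= 1 -> is_derive t 1 f1 (f2 t)) ->
  (forall t, 0 <= t <= 1 -> 0 <= f2 t) -> f 0 + f1 0 <= f 1.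
Proof.
move=> df df1 f2ge0.
have cts (h h1 : R -> R) (b : R) : b <= 1 ->
    (forall t, 0 <= t <= 1 -> is_derive t 1 h (h1 t)) ->
    {within `[0, b], continuous h}.
  move=> b1 dh; apply: derivable_within_continuous => t /=.
  rewrite in_itv/= => /andP[t0 tb].
  by have [] : is_derive t 1 h (h1 t) by apply: dh; rewrite t0 (le_trans tb).
have [|c c01 fE] := @MVT_segment R f f1 0 1 ler01 _ (cts _ _ _ (lexx _) df).
  by move=> t; rewrite in_itv/= => /andP[? ?]; apply: df; rewrite !ltW.
move: c01; rewrite in_itv/= => /andP[c0 c1].
have [|e e0c f1E] := @MVT_segment R f1 f2 0 c c0 _ (cts _ _ _ c1 df1).
  move=> t; rewrite in_itv/= => /andP[? tc]; apply: df1.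
  by rewrite !ltW ?(lt_le_trans tc).
have f2e : 0 <= f2 e.
  by move: e0c; rewrite in_itv/= => /andP[e0 ec]; apply: f2ge0; rewrite e0 (le_trans ec).
have : 0 <= f2 e * (c - 0) by apply: mulr_ge0 => //; rewrite subr0.
rewrite -f1E => h.
move: fE; rewrite subr0 mulr1; lra.
Qed.

(** The even part [h t = f t + f (- t)] has derivative [f1 t - f1 (- t)], whose own derivative at 0
    is [2 * f2]. If [f2] were negative, [h] would decrease just to the right of 0, against midpoint
    convexity. *)
Lemma midconvex_derive2_ge0 (f f1 : R -> R) (f2 r : R) : 0 < r ->
  (forall t, -r < t < r -> is_derive t 1 f (f1 t)) ->
  is_derive (0:R) 1 f1 f2 ->
  (forall t, 0 < t < r -> f 0 *+ 2 <= f t + f (- t)) -> 0 <= f2.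
Proof.
move=> r0 df df1 fmid; rewrite leNgt; apply/negP => f20.
pose h t := f t + f (- t).
have dN (k : R -> R) k' t : is_derive (- t) 1 k k' ->
    is_derive t 1 (fun s => k (- s)) (- k').
  move=> dk; have := @is_derive_line k 0 (-1) t k'.
  rewrite add0r mulrN1 => /(_ dk); rewrite mulrN1.
  by under eq_fun do rewrite add0r mulrN1.
have dh t : -r < t < r -> is_derive t 1 h (f1 t - f1 (- t)).
  move=> tr; apply: is_derive_funD; first exact: df.
  by apply: dN; apply: df; lra.
have [d d0 h1] : exists2 d : R, 0 < d & forall t, 0 < t < d -> f1 t - f1 (- t) < 0.
  have : is_derive (0:R) 1 (fun t => f1 t - f1 (- t)) (f2 + - - f2).
    apply: is_derive_funD => //; apply: is_derive_funN.
    by apply: dN; rewrite oppr0.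
  case => dq dqE; pose g t := f1 t - f1 (- t).
  have /cvgrPdist_lt : (fun s => s^-1 *: ((g \o shift 0) (s *: (1 : R)) - g 0))
      @ (0 : R)^' --> f2 - - f2.
    by rewrite -dqE; exact: dq.
  rewrite opprK /=.
  (* The difference quotients tend to [2 * f2]; within distance [- f2] of this limit they are below
     [f2], hence negative. *)
  have f2' : 0 < - f2 by rewrite oppr_gt0.
  move=> /(_ _ f2'); rewrite /dnbhs /within /= => -[d /= d0 dP].
  exists d => // t /andP[t0 td].
  have := dP t; rewrite /ball_ /= sub0r normrN gtr0_norm // => /(_ td (lt0r_neq0 t0)).
  rewrite /g oppr0 subrr subr0 addr0 /GRing.scale /= mulr1 => hq.
  set q := f1 t - f1 (- t) in hq *.
  have : q / t < 0 by rewrite mulrC; move: hq; rewrite ltr_norml; lra.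
  by rewrite pmulr_llt0 // invr_gt0.
pose b := (Order.min d r) / 2.
have b0 : 0 < b by rewrite divr_gt0 // lt_min d0 r0.
have [bd br] : b < d /\ b < r.
  by split; rewrite /b; case: (leP d r) => ?; lra.
have [| |c c0b hE] := @MVT R h (fun t => f1 t - f1 (- t)) 0 b b0 _ _.
- by move=> t; rewrite in_itv/= => /andP[? ?]; apply: dh; lra.
- apply: derivable_within_continuous => t; rewrite in_itv/= => /andP[? ?].
  by have [] : is_derive t 1 h (f1 t - f1 (- t)) by apply: dh; lra.
move: c0b; rewrite in_itv/= => /andP[c0 cb].
have : h b - h 0 < 0 by rewrite hE nmulr_rlt0 ?h1; lra.
have := fmid b; rewrite /h oppr0 mulr2n; lra.
Qed.
End derive_rules.

Section bregman.
Context {R : realType}.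
Variables (J : set R) (P0 P1 P2 P3 P4 : R -> R).
Hypothesis Jopen : open J.
Hypothesis Jitv : is_interval J.
Hypothesis dP0 : forall u, J u -> is_derive u 1 P0 (P1 u).
Hypothesis dP1 : forall u, J u -> is_derive u 1 P1 (P2 u).
Hypothesis dP2 : forall u, J u -> is_derive u 1 P2 (P3 u).
Hypothesis dP3 : forall u, J u -> is_derive u 1 P3 (P4 u).

Lemma interval_segment (A : set R) (x y t : R) : is_interval A ->
  A x -> A y -> 0 <= t <= 1 -> A (x + t * (y - x)).
Proof.
move=> Aitv Ax Ay /andP[t0 t1]; have [xy|yx] := leP x y.
  by apply: (Aitv x y) => //; nra.
by apply: (Aitv y x) => //; nra.
Qed.

Hypothesis F_midconvex : forall u v s r, J (u + s) -> J (u - s) ->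
  J (v + r) -> J (v - r) ->
  (P2 u * v ^+ 2) *+ 2 <=
  P2 (u + s) * (v + r) ^+ 2 + P2 (u - s) * (v - r) ^+ 2.

(* With x = s * v, this is the Hessian of (u, v) |-> P2 u * v ^+ 2 in the
   direction (s, r).  It only depends on the product s * v, so that restricting
   v to J loses nothing. *)
Lemma hessian_ge0 u x r : J u ->
  0 <= P4 u * x ^+ 2 + 4 * P3 u * x * r + 2 * P2 u * r ^+ 2.
Proof.
have openJ w : J w -> exists2 e : R, 0 < e & forall z, `|z| < e -> J (w + z).
  move=> Jw; have /nbhs_ballP[e /= e0 eJ] := open_nbhs_nbhs (conj Jopen Jw).
  by exists e => // z ze; apply: eJ; rewrite /ball/= opprD addNKr normrN.
(* The direction will be [(s, r)] with [s * v = x], so [v] must be invertible; if [u] is 0, openness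
   of [J] provides a nonzero point next to it. *)
move=> Ju; have [v v0 Jv] : exists2 v, v != 0 & J v.
  have [uE|u0] := eqVneq u 0; last by exists u.
  have [e e0 eJ] := openJ _ Ju; exists (u + e / 2).
    by rewrite uE add0r lt0r_neq0// divr_gt0.
  by apply: eJ; rewrite gtr0_norm; lra.
pose s := x / v.
have [eu eu0 euJ] := openJ _ Ju; have [ev ev0 evJ] := openJ _ Jv.
(* For [|t| < e], both [|t * s|] and [|t * r|] are below both radii; the summand 1 keeps the
   denominator positive. *)
pose e := Order.min eu ev / (1 + `|s| + `|r|).
have n0 : 0 < 1 + `|s| + `|r| by rewrite -addrA ltr_pwDl ?addr_ge0.
have e0 : 0 < e by rewrite divr_gt0// lt_min eu0.
have nst t : -e < t < e -> J (u + t * s) /\ J (v + t * r).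
  move=> /andP[te1 te2]; have te : `|t| < e by rewrite ltr_norml te1.
  have : `|t| * (1 + `|s| + `|r|) < Order.min eu ev by rewrite -ltr_pdivlMr.
  rewrite lt_min => /andP[teu tev]; split; [apply: euJ|apply: evJ]; rewrite normrM.
    apply: le_lt_trans teu; apply: ler_wpM2l => //.
    by have := normr_ge0 r; lra.
  apply: le_lt_trans tev; apply: ler_wpM2l => //.
  by have := normr_ge0 s; lra.
pose f t := P2 (u + t * s) * ((v + t * r) * (v + t * r)).
pose f1 t := P3 (u + t * s) * s * ((v + t * r) * (v + t * r))
             + 2 * (P2 (u + t * s) * (v + t * r)) * r.
have dl (t : R) : is_derive t 1 (fun t => v + t * r) r.
  by have := @is_derive_line _ id v r t 1 (is_derive_id _ _); rewrite mul1r.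
have df (t : R) : -e < t < e -> is_derive t 1 f (f1 t).
  move=> /nst[Jt _]; have := is_derive_funM (is_derive_line (dP2 Jt))
    (is_derive_funM (dl t) (dl t)).
  by move=> /is_derive_eq; apply; rewrite /f1; ring.
have df1 : is_derive (0 : R) 1 f1 (P4 u * x ^+ 2 + 4 * P3 u * x * r + 2 * P2 u * r ^+ 2).
  have [|Jt _] := nst 0; first by lra.
  have := is_derive_funD
   (is_derive_funM (is_derive_funM (is_derive_line (dP3 Jt)) (is_derive_const s _))
     (is_derive_funM (dl 0) (dl 0)))
   (is_derive_funM (is_derive_funM (is_derive_const 2 _)
     (is_derive_funM (is_derive_line (dP2 Jt)) (dl 0))) (is_derive_const r _)).
  move=> /is_derive_eq; apply; rewrite /= !mul0r !addr0 /cst /s.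
  by field.
apply: (midconvex_derive2_ge0 e0 df df1) => t /andP[t0 te].
have [|Jut Jvt] := nst t; first by lra.
have [|JuNt JvNt] := nst (- t); first by lra.
rewrite /f !mul0r !addr0 -!expr2 !mulNr.
by apply: F_midconvex; rewrite -?mulNr.
Qed.

(** The left side is the Taylor polynomial of F at [(z0, d)], the gradient being
    [(P3 z0 * d ^+ 2, 2 * P2 z0 * d)]. Along the segment the second derivative is the form of
    [hessian_ge0] with [x = (z1 - z0) * v t] and [r = e - d]. As [x] is arbitrary there, [d] and [e]
    can be any reals, which is needed since they will be velocities. *)
Lemma form_tangent z0 z1 d e : J z0 -> J z1 ->
  P2 z0 * d ^+ 2 + P3 z0 * d ^+ 2 * (z1 - z0) + 2 * P2 z0 * d * (e - d)
  <= P2 z1 * e ^+ 2.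
Proof.
move=> J0 J1; pose z t := z0 + t * (z1 - z0); pose v t := d + t * (e - d).
have Jz t : 0 <= t <= 1 -> J (z t) by move=> ?; exact: interval_segment.
pose f t := P2 (z t) * (v t * v t).
pose f1 t := P3 (z t) * (z1 - z0) * (v t * v t) + 2 * (P2 (z t) * v t) * (e - d).
pose f2 t := P4 (z t) * ((z1 - z0) * v t) ^+ 2 +
  4 * P3 (z t) * ((z1 - z0) * v t) * (e - d) + 2 * P2 (z t) * (e - d) ^+ 2.
have dv (t : R) : is_derive t 1 v (e - d).
  by have := @is_derive_line _ id d (e - d) t 1 (is_derive_id _ _); rewrite mul1r.
have df (t : R) : 0 <= t <= 1 -> is_derive t 1 f (f1 t).
  move=> /Jz Jt; have := is_derive_funM (is_derive_line (dP2 Jt))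
    (is_derive_funM (dv t) (dv t)).
  by move=> /is_derive_eq; apply; rewrite /f1 /z; ring.
have df1 (t : R) : 0 <= t <= 1 -> is_derive t 1 f1 (f2 t).
  move=> /Jz Jt; have := is_derive_funD
   (is_derive_funM
     (is_derive_funM (is_derive_line (dP3 Jt)) (is_derive_const (z1 - z0) _))
     (is_derive_funM (dv t) (dv t)))
   (is_derive_funM (is_derive_funM (is_derive_const 2 _)
     (is_derive_funM (is_derive_line (dP2 Jt)) (dv t))) (is_derive_const (e - d) _)).
  by move=> /is_derive_eq; apply; rewrite /f2 /cst /z /=; ring.
have := convex_ge_tangent df df1 (fun t t01 => hessian_ge0 _ _ (Jz t t01)).
rewrite /f /f1 /z /v !mul0r !mul1r !addr0.
have -> : z0 + (z1 - z0) = z1 by ring.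
have -> : d + (e - d) = e by ring.
by apply: le_trans; rewrite le_eqVlt; apply/orP; left; apply/eqP; ring.
Qed.

(** The left side is the tangent plane of D at [(a, b)]: the partial derivatives there are
    [P1 a - P1 b] and [- P2 b * (a - b)]. *)
Lemma bregman_tangent u w a b : J u -> J w -> J a -> J b ->
  P0 a - P0 b - P1 b * (a - b) + (P1 a - P1 b) * (u - a) - P2 b * (a - b) * (w - b)
  <= P0 u - P0 w - P1 w * (u - w).
Proof.
move=> Ju Jw Ja Jb.
(* [k] and [c] make f 0 = 0 and f' 0 = 0; then f 1 is the difference of the two
   sides, and f'' >= 0 is [form_tangent]. *)
pose e := u - w; pose d := a - b.
(* The difference of the two sides is unchanged when [a] and [w] are exchanged, and the segment used
   runs from [(w, b)] to [(u, a)]. Thus [f t] is D at [(z1 t, z0 t)] plus an affine function of [t],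
   and [f2 t] is the gap in [form_tangent] between [(z0 t, d)] and [(z1 t, e)]. *)
pose z1 t := w + t * e; pose z0 t := b + t * d.
pose c := P2 b * (w - b) * d + P1 b * (e - d) - P1 w * e + P1 b * d.
pose k := P1 b * (w - b) - P0 w + P0 b.
pose f t := P0 (z1 t) + - P0 (z0 t) + - (P1 (z0 t) * ((w - b) + t * (e - d)))
  + (k + t * c).
pose f1 t := P1 (z1 t) * e + - (P1 (z0 t) * d)
  + - (P2 (z0 t) * d * ((w - b) + t * (e - d)) + P1 (z0 t) * (e - d)) + c.
pose f2 t := P2 (z1 t) * e ^+ 2 - (P2 (z0 t) * d ^+ 2 +
  P3 (z0 t) * d ^+ 2 * (z1 t - z0 t) + 2 * P2 (z0 t) * d * (e - d)).
have Jz1 t : 0 <= t <= 1 -> J (z1 t) by move=> ?; exact: interval_segment.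
have Jz0 t : 0 <= t <= 1 -> J (z0 t) by move=> ?; exact: interval_segment.
have dl (x y t : R) : is_derive t 1 (fun t => x + t * y) y.
  by have := @is_derive_line _ id x y t 1 (is_derive_id _ _); rewrite mul1r.
have df (t : R) : 0 <= t <= 1 -> is_derive t 1 f (f1 t).
  move=> t01; have J1 := Jz1 t t01; have J0 := Jz0 t t01.
  have := is_derive_funD (is_derive_funD (is_derive_funD (is_derive_line (dP0 J1))
     (is_derive_funN (is_derive_line (dP0 J0))))
     (is_derive_funN (is_derive_funM (is_derive_line (dP1 J0)) (dl (w - b) (e - d) t))))
     (dl k c t).
  by move=> /is_derive_eq; apply; rewrite /f1 /z0 /z1; ring.
have df1 (t : R) : 0 <= t <= 1 -> is_derive t 1 f1 (f2 t).
  move=> t01; have J1 := Jz1 t t01; have J0 := Jz0 t t01.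
  have := is_derive_funD (is_derive_funD (is_derive_funD
     (is_derive_funM (is_derive_line (dP1 J1)) (is_derive_const e _))
     (is_derive_funN (is_derive_funM (is_derive_line (dP1 J0)) (is_derive_const d _))))
     (is_derive_funN (is_derive_funD
        (is_derive_funM (is_derive_funM (is_derive_line (dP2 J0)) (is_derive_const d _))
            (dl (w - b) (e - d) t))
        (is_derive_funM (is_derive_line (dP1 J0)) (is_derive_const (e - d) _)))))
     (is_derive_const c t).
  by move=> /is_derive_eq; apply; rewrite /f2 /cst /z0 /z1 /=; ring.
have f2ge0 t : 0 <= t <= 1 -> 0 <= f2 t.
  by move=> t01; rewrite subr_ge0; apply: form_tangent; [exact: Jz0|exact: Jz1].
have := convex_ge_tangent df df1 f2ge0.
rewrite /f /f1 /z1 /z0 !mul0r !mul1r !addr0 /k /c /e /d.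
have -> : w + (u - w) = u by ring.
have -> : b + (a - b) = a by ring.
lra.
Qed.

End bregman.

Section derivative_condition.
Context {R : realType}.
Variables (I : set R) (Phi : R -> R).
Let J := interior I.

Lemma interior_between (A : set R) (x y z : R) : is_interval A ->
  A x -> A y -> x < z < y -> (interior A) z.
Proof.
move=> Aitv Ax Ay /andP[xz zy].
have : `]x, y[ `<=` A.
  move=> t /=; rewrite in_itv/= => /andP[xt ty].
  by apply: (Aitv x y); rewrite ?(ltW xt) ?ltW.
rewrite open_subsetE; last exact: interval_open.
by apply; rewrite /= in_itv/= xz.
Qed.

Lemma is_interval_interior (A : set R) : is_interval A -> is_interval (interior A).
Proof.
move=> Aitv x y Ax Ay z /andP[]; rewrite le_eqVlt => /predU1P[<-//|xz].
rewrite le_eqVlt => /predU1P[->//|zy].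
by apply: (interior_between Aitv (interior_subset Ax) (interior_subset Ay)); rewrite xz.
Qed.

Lemma condition_midconvex : second_derivative_condition I Phi ->
  forall u v s r, J (u + s) -> J (u - s) -> J (v + r) -> J (v - r) ->
  (derive1n 2 Phi u * v ^+ 2) *+ 2 <=
  derive1n 2 Phi (u + s) * (v + r) ^+ 2 + derive1n 2 Phi (u - s) * (v - r) ^+ 2.
Proof.
move=> [_ Fcvx] u v s r J1 J2 J3 J4.
have h0 : 0 <= 2^-1 :> R by rewrite invr_ge0.
have h1 : 2^-1 <= 1 :> R by rewrite invf_le1// ler1n.
have := Fcvx (Itv01 h0 h1) (u + s, v + r) (u - s, v - r).
rewrite !inE => /(_ (conj J1 (interior_subset J3) : (I° `*` I) (u + s, v + r))).
move=> /(_ (conj J2 (interior_subset J4) : (I° `*` I) (u - s, v - r))).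
have onem2 : unstable.onem 2^-1 = 2^-1 :> R by rewrite /unstable.onem; field.
rewrite !convRE /conv/= /GRing.scale/= !onem2.
have -> : 2^-1 * (u + s) + 2^-1 * (u - s) = u by field.
have -> : 2^-1 * (v + r) + 2^-1 * (v - r) = v by field.
rewrite -[leLHS]/(derive1n 2 Phi u * v ^+ 2) -mulrDr => h.
by rewrite -mulr_natl -ler_pdivlMl// h.
Qed.

End derivative_condition.

(** * One-sided truncations decrease the Bregman divergence *)

Section convex_clamp.
Context {R : realType}.
Variables (I : set R) (P0 P1 : R -> R).
Let J := interior I.
Hypothesis Iitv : is_interval I.
Hypothesis P0cont : {within I, continuous P0}.
Hypothesis dP0 : forall u, J u -> is_derive u 1 P0 (P1 u).
Hypothesis P1nd : forall u v, J u -> J v -> u <= v -> P1 u <= P1 v.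

(** Here [x] and [y] may be endpoints of [I], where [P0] is only continuous; the intermediate point
    is interior, so [P1] is evaluated only where it is a derivative. *)
Let mean_value x y : I x -> I y -> x <= y ->
  x = y \/ exists2 c, x < c < y & J c /\ P0 y - P0 x = P1 c * (y - x).
Proof.
move=> Ix Iy; rewrite le_eqVlt => /predU1P[->|xy]; [by left|right].
have [| |c] := @MVT R P0 P1 x y xy.
- move=> t; rewrite in_itv/= => txy; apply: dP0.
  exact: interior_between Iitv Ix Iy txy.
- apply: continuous_subspaceW P0cont => t /=; rewrite in_itv/=.
  exact: Iitv.
rewrite in_itv/= => cxy P0E; exists c => //; split => //.
exact: interior_between Iitv Ix Iy cxy.
Qed.

Lemma le_increment x y s : I x -> I y -> x <= y ->
  (forall c, x < c < y -> J c -> s <= P1 c) -> s * (y - x) <= P0 y - P0 x.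
Proof.
move=> Ix Iy xy sP1; have [->|[c cxy [Jc ->]]] := mean_value Ix Iy xy.
  by rewrite !subrr mulr0.
by rewrite ler_wpM2r ?subr_ge0// sP1.
Qed.

Lemma ge_increment x y s : I x -> I y -> x <= y ->
  (forall c, x < c < y -> J c -> P1 c <= s) -> P0 y - P0 x <= s * (y - x).
Proof.
move=> Ix Iy xy sP1; have [->|[c cxy [Jc ->]]] := mean_value Ix Iy xy.
  by rewrite !subrr mulr0.
by rewrite ler_wpM2r ?subr_ge0// sP1.
Qed.

Definition bregman u c := P0 u - P0 c - P1 c * (u - c).

Lemma bregman_ge0 u c : I u -> J c -> 0 <= bregman u c.
Proof.
move=> Iu Jc; have Ic := interior_subset Jc; rewrite /bregman.
have [cu|/ltW uc] := leP c u.
  rewrite subr_ge0; apply: le_increment => // b /andP[cb _] Jb.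
  by apply: P1nd => //; exact: ltW.
have := @ge_increment u c (P1 c) Iu Ic uc; rewrite -subr_ge0.
move=> h; rewrite (_ : _ - _ = P1 c * (c - u) - (P0 c - P0 u)); last by ring.
by apply: h => b /andP[_ bc] Jb; apply: P1nd => //; exact: ltW.
Qed.

(** D decreases when either argument moves toward the other. If exactly one of [u], [m] exceeds [b],
    truncation is such a move; if both do, they merge and D becomes 0. *)
Lemma bregman_minr u m b : I u -> J m -> J b ->
  bregman (Order.min u b) (Order.min m b) <= bregman u m.
Proof.
move=> Iu Jm Jb; have Im := interior_subset Jm; have Ib := interior_subset Jb.
have [mb|bm] := leP m b; have [ub|bu] := leP u b => //.
- have := @le_increment b u (P1 m) Ib Iu (ltW bu); rewrite /bregman.
  have P1mb : forall c, b < c < u -> J c -> P1 m <= P1 c.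
    by move=> c /andP[bc _] Jc; apply: P1nd => //; lra.
  by move=> /(_ P1mb); lra.
- have := @ge_increment b m (P1 m) Ib Im (ltW bm); rewrite /bregman.
  have P1cm : forall c, b < c < m -> J c -> P1 c <= P1 m.
    by move=> c /andP[_ cm] Jc; apply: P1nd => //; lra.
  move=> /(_ P1cm); have := P1nd Jb Jm (ltW bm) => h.
  have : P1 b * (b - u) <= P1 m * (b - u) by rewrite ler_wpM2r// subr_ge0.
  lra.
- by rewrite {1}/bregman !subrr mulr0 subr0; exact: bregman_ge0.
Qed.

Lemma bregman_maxr u m a : I u -> J m -> J a ->
  bregman (Order.max u a) (Order.max m a) <= bregman u m.
Proof.
move=> Iu Jm Ja; have Im := interior_subset Jm; have Ia := interior_subset Ja.
have [ma|am] := leP m a; have [ua|au] := leP u a => //.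
- by rewrite {1}/bregman !subrr mulr0 subr0; exact: bregman_ge0.
- have := @le_increment m a (P1 m) Im Ia ma; rewrite /bregman.
  have P1mc : forall c, m < c < a -> J c -> P1 m <= P1 c.
    by move=> c /andP[mc _] Jc; apply: P1nd => //; lra.
  move=> /(_ P1mc); have := P1nd Jm Ja ma => h.
  have : P1 m * (u - a) <= P1 a * (u - a) by rewrite ler_wpM2r// subr_ge0 ltW.
  lra.
- have := @ge_increment u a (P1 m) Iu Ia ua; rewrite /bregman.
  have P1cm : forall c, u < c < a -> J c -> P1 c <= P1 m.
    by move=> c /andP[_ ca] Jc; apply: P1nd => //; lra.
  by move=> /(_ P1cm); lra.
Qed.

End convex_clamp.

(** * Product spaces and coordinatewise averages *)

Section product_space.
Context {R : realType} (n : nat) (d : 'I_n -> measure_display)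
  (T : forall i : 'I_n, measurableType (d i)).
Implicit Types (x : prod_space T) (i j k : 'I_n).

Definition replace x i (y : T i) : prod_space T :=
  @dfwith 'I_n (fun j => T j) x i y.

Lemma replace_in x i (y : T i) : replace x y i = y.
Proof. exact: dfwithin. Qed.

Lemma replace_out x i (y : T i) k : i != k -> replace x y k = x k.
Proof. exact: dfwithout. Qed.

Lemma replace_same x i (y z : T i) : replace (replace x y) z = replace x z.
Proof.
apply: functional_extensionality_dep => k.
have [ik|ik] := eqVneq i k; last by rewrite !replace_out.
by case: _ / ik; rewrite !replace_in.
Qed.

Lemma replace_comm x i j (y : T i) (z : T j) : i != j ->
  replace (replace x y) z = replace (replace x z) y.
Proof.
move=> ij; apply: functional_extensionality_dep => k.
have [ik|ik] := eqVneq i k.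
  by case: _ / ik; rewrite replace_in replace_out 1?eq_sym// replace_in.
have [jk|jk] := eqVneq j k; last by rewrite !replace_out.
by case: _ / jk; rewrite replace_in replace_out// replace_in.
Qed.

(** Replacing the coordinates of [x] by those of [x'] one after the other, along an enumeration of
    the finite index set, leads from [x] to [x']. *)
Lemma replace_connected (U : Type) (h : prod_space T -> U) :
  (forall i x (y : T i), h (replace x y) = h x) -> forall x x', h x = h x'.
Proof.
move=> hr x x'.
pose g := foldl (fun z i => replace z (x' i)) x.
have hg s : h (g s) = h x.
  by elim/last_ind: s => // s i IH; rewrite /g foldl_rcons hr.
have gx' s k : k \in s -> g s k = x' k.
  elim/last_ind: s => // s i IH; rewrite mem_rcons inE /g foldl_rcons -/(g s).
  have [ki _|ki /= ks] := eqVneq k i; first by subst k; rewrite replace_in.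
  by rewrite replace_out 1?eq_sym// IH.
rewrite -(hg (enum 'I_n)); congr h.
by apply: functional_extensionality_dep => k; rewrite gx' ?mem_enum.
Qed.

Lemma measurable_coord i : measurable_fun setT (fun x : prod_space T => x i).
Proof.
move=> _ A mA; rewrite setTI; apply: sub_sigma_algebra.
by exists i => //; exists A => //; rewrite setTI.
Qed.

Lemma measurable_fun_prod_space (dS : measure_display) (S : measurableType dS)
    (F : S -> prod_space T) :
  (forall i, measurable_fun setT (fun s => F s i)) -> measurable_fun setT F.
Proof.
move=> mF; apply: (@measurability _ _ S (prod_space T) setT F (@cylinders n d T)) => //.
move=> _ [_ [i _ [A mA <-]] <-]; rewrite !setTI.
by have := mF i measurableT A mA; rewrite setTI.
Qed.

Lemma measurable_replace i :
  measurable_fun setT (fun p : prod_space T * T i => replace p.1 p.2).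
Proof.
apply: measurable_fun_prod_space => k.
have [ik|ik] := eqVneq i k.
  case: _ / ik; apply: (eq_measurable_fun snd) => [p _|]; last exact: measurable_snd.
  by rewrite replace_in.
apply: (eq_measurable_fun (fun p : prod_space T * T i => p.1 k)) => [p _|].
  by rewrite replace_out.
have := @measurableT_comp _ _ _ (prod_space T * T i)%type (prod_space T) (T k)
  (fun x => x k) setT fst.
by apply; [exact: measurable_coord|exact: measurable_fst].
Qed.

Definition box (A : forall i, set (T i)) : set (prod_space T) :=
  [set x | forall i, A i (x i)].

Lemma measurable_box (A : forall i, set (T i)) :
  (forall i, measurable (A i)) -> measurable (box A).
Proof.
move=> mA; rewrite (_ : box A =
    \bigcap_(i in [set: 'I_n]) ((fun x : prod_space T => x i) @^-1` (A i))).
  apply: fin_bigcap_measurable => // i _.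
  by rewrite -[X in measurable X]setTI; exact: measurable_coord.
by apply/seteqP; split=> [x Ax i _|x Ax i]; [exact: Ax|exact: Ax].
Qed.

Lemma measurable_prod_spaceE : @measurable _ (prod_space T) =
  <<s [set B | exists2 A : forall i, set (T i),
                 (forall i, measurable (A i)) & B = box A] >>.
Proof.
apply/seteqP; split.
  apply: smallest_sub; first exact: smallest_sigma_algebra.
  move=> _ [i _ [A mA <-]]; apply: sub_sigma_algebra.
  exists (@dfwith 'I_n (fun j => set (T j)) (fun j => setT) i A).
    by move=> k; case: dfwithP.
  rewrite setTI; apply/seteqP; split=> [x Ax k|x Ax] /=; first by case: dfwithP.
  by have := Ax i; rewrite dfwithin.
apply: smallest_sub; first exact: sigma_algebra_measurable.
by move=> _ [A mA ->]; exact: measurable_box.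
Qed.

Lemma prod_space_measure_unique (m1 m2 : {measure set (prod_space T) -> \bar R}) :
  (m1 setT < +oo)%E ->
  (forall A : forall i, set (T i), (forall i, measurable (A i)) ->
    m1 (box A) = m2 (box A)) ->
  forall B, measurable B -> m1 B = m2 B.
Proof.
move=> m1oo m12.
apply: (measure_unique _ (fun=> setT) measurable_prod_spaceE) => //.
- move=> _ _ [A mA ->] [B mB ->]; exists (fun i => A i `&` B i).
    by move=> i; exact: measurableI.
  apply/seteqP; split=> [x [Ax Bx] i|x ABx]; first by split.
  by split=> i; have [] := ABx i.
- by move=> _; exists (fun=> setT) => //; apply/seteqP; split.
- by apply/seteqP; split=> // x _; exists 0.
- by move=> _ [A mA ->]; exact: m12.
Qed.

Variables (mu_ : forall i, probability (T i) R) (mu : probability (prod_space T) R).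
Hypothesis mu_prod : is_product_measure mu_ mu.

(** Resampling one coordinate independently preserves the law. By uniqueness it is enough to test a
    box [A]: its preimage is the rectangle [box A' * A i], where [A'] has full i-th side, and the
    i-th factor of [mu (box A')] is 1. The product rule for [mu] enters the proof here. *)
Lemma pushforward_replace i (B : set (prod_space T)) : measurable B ->
  (mu \x mu_ i)%E ((fun p : prod_space T * T i => replace p.1 p.2) @^-1` B) = mu B.
Proof.
move: B; pose r (p : prod_space T * T i) := replace p.1 p.2.
pose mr : measurable_fun setT r := @measurable_replace i.
pose mr_mixin := isMeasurableFun.Build _ _ _ _ r mr.
pose r' : {mfun _ >-> _} := HB.pack r mr_mixin.
suff h : forall B, measurable B -> pushforward (mu \x mu_ i)%E r' B = mu B by exact: h.
apply: prod_space_measure_unique.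
  apply: (@le_lt_trans _ _ ((mu \x mu_ i)%E (setT `*` setT))); first by rewrite setXTT.
  rewrite product_measure1E//.
  have lt1 (z : \bar R) : z = 1%E -> (z < +oo)%E by move=> ->; rewrite ltry.
  by apply: lt1; rewrite -[RHS]mule1; congr (_ * _)%E; exact: probability_setT.
move=> A mA.
pose A' := @dfwith 'I_n (fun j => set (T j)) A i setT.
have mA' k : measurable (A' k) by rewrite /A'; case: dfwithP.
rewrite /pushforward.
transitivity ((mu \x mu_ i)%E (box A' `*` A i)); last first.
  transitivity (mu (box A') * mu_ i (A i))%E.
    by apply: product_measure1E => //; exact: measurable_box.
  transitivity ((\prod_(k < n) mu_ k (A' k)) * mu_ i (A i))%E.
    by congr (_ * _)%E; exact: mu_prod.
  apply: etrans (esym (mu_prod mA)).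
  rewrite (bigD1 i)//= /A' dfwithin probability_setT mul1e.
  rewrite [RHS](bigD1 i)//= muleC; congr (_ * _)%E.
  by apply: eq_bigr => k ki; rewrite dfwithout// eq_sym.
congr ((mu \x mu_ i)%E _); apply/seteqP; split => -[x y] /=.
  move=> Axy; split; last by have := Axy i; rewrite /r replace_in.
  move=> k; rewrite /A'; case: dfwithP => // j ij.
  by have := Axy j; rewrite /r replace_out.
move=> [A'x Ay] k; rewrite /r/=; have [ik|ik] := eqVneq i k.
  by case: _ / ik; rewrite replace_in.
by rewrite replace_out//; have := A'x k; rewrite /A' dfwithout.
Qed.

End product_space.

(** * Bounded measurable functions and the rules for their real-valued means *)

Definition bounded_measurable (R : realType) (d : measure_display)
    (S : measurableType d) (h : S -> R) :=
  measurable_fun setT h /\ exists M : R, forall x, `|h x| <= M.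

Section bounded_measurable.
Context {R : realType} (d : measure_display) (S : measurableType d).
Implicit Types h g : S -> R.

Lemma bounded_measurable_cst (c : R) : bounded_measurable (fun _ : S => c).
Proof. by split; [exact: measurable_cst|exists `|c|]. Qed.

Lemma bounded_measurableD h g : bounded_measurable h -> bounded_measurable g ->
  bounded_measurable (fun x => h x + g x).
Proof.
move=> [mh [M hM]] [mg [N gN]]; split; first exact: measurable_funD.
by exists (M + N) => x; rewrite (le_trans (ler_normD _ _))// lerD.
Qed.

Lemma bounded_measurableN h : bounded_measurable h ->
  bounded_measurable (fun x => - h x).
Proof.
move=> [mh [M hM]]; split; first exact: measurableT_comp.
by exists M => x; rewrite normrN.
Qed.

Lemma bounded_measurableB h g : bounded_measurable h -> bounded_measurable g ->
  bounded_measurable (fun x => h x - g x).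
Proof. by move=> bh /bounded_measurableN; exact: bounded_measurableD. Qed.

Lemma bounded_measurableM h g : bounded_measurable h -> bounded_measurable g ->
  bounded_measurable (fun x => h x * g x).
Proof.
move=> [mh [M hM]] [mg [N gN]]; split; first exact: measurable_funM.
by exists (M * N) => x; rewrite normrM ler_pM.
Qed.

Lemma bounded_measurable_itv h (al be : R) : measurable_fun setT h ->
  (forall x, al <= h x <= be) -> bounded_measurable h.
Proof.
move=> mh hab; split => //; exists (`|al| + `|be|) => x.
have /andP[ah hb] := hab x; rewrite ler_norml; apply/andP; split.
  apply: le_trans ah; have := ler_norm (- al); have := normr_ge0 be.
  by rewrite normrN; lra.
by apply: le_trans hb _; have := ler_norm be; have := normr_ge0 al; lra.
Qed.

Variable Q : {finite_measure set S -> \bar R}.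

Lemma bounded_measurable_integrable h : bounded_measurable h ->
  Q.-integrable setT (EFin \o h).
Proof.
move=> [mh [M hM]]; apply: measurable_bounded_integrable => //.
  by rewrite -ge0_fin_numE// fin_num_measure.
exists M; split; first by rewrite num_real.
by move=> N MN x _ /=; rewrite (le_trans (hM x))// ltW.
Qed.

Lemma EFin_Rintegral h : bounded_measurable h ->
  (\int[Q]_x h x)%R%:E = (\int[Q]_x (h x)%:E)%E.
Proof.
by move=> /bounded_measurable_integrable hi; rewrite fineK//; exact: integrable_fin_num.
Qed.

End bounded_measurable.

Lemma bounded_measurable_comp (R : realType) (d d' : measure_display)
    (S : measurableType d) (S' : measurableType d') (h : S -> R) (phi : S' -> S) :
  measurable_fun setT phi -> bounded_measurable h -> bounded_measurable (h \o phi).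
Proof.
move=> mphi [mh [M hM]]; split; first exact: measurableT_comp.
by exists M => x /=.
Qed.

Section mean.
Context {R : realType} (d : measure_display) (S : measurableType d).
Variable Q : probability S R.
Implicit Types u w : S -> R.
Let BI := @bounded_measurable_integrable R d S Q.

Lemma mean_cst (c : R) : (\int[Q]_x c)%R = c.
Proof.
rewrite Rintegral_cst// -[RHS]mulr1; congr (_ * _).
by rewrite -[RHS]/(fine 1%E); congr fine; exact: probability_setT.
Qed.

Lemma mean_le u w : bounded_measurable u -> bounded_measurable w ->
  (forall x, u x <= w x) -> (\int[Q]_x u x <= \int[Q]_x w x)%R.
Proof. by move=> /BI ? /BI ? uw; apply: le_Rintegral. Qed.

Lemma meanB u w : bounded_measurable u -> bounded_measurable w ->
  (\int[Q]_x (u x - w x) = \int[Q]_x u x - \int[Q]_x w x)%R.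
Proof. by move=> /BI ? /BI ?; apply: RintegralB. Qed.

Lemma meanD u w : bounded_measurable u -> bounded_measurable w ->
  (\int[Q]_x (u x + w x) = \int[Q]_x u x + \int[Q]_x w x)%R.
Proof. by move=> /BI ? /BI ?; apply: RintegralD. Qed.

Lemma meanZ (c : R) u : bounded_measurable u ->
  (\int[Q]_x (c * u x) = c * \int[Q]_x u x)%R.
Proof. by move=> /BI ?; apply: RintegralZl. Qed.

Lemma mean_itv u (al be : R) : measurable_fun setT u ->
  (forall x, al <= u x <= be) -> al <= \int[Q]_x u x <= be.
Proof.
move=> mu uab; have bu := bounded_measurable_itv mu uab.
apply/andP; split; [rewrite -[leLHS]mean_cst|rewrite -[leRHS]mean_cst];
  apply: mean_le => //; try exact: bounded_measurable_cst;
  by move=> x; have /andP[] := uab x.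
Qed.

Lemma mean_affine u w (c a b : R) : bounded_measurable u -> bounded_measurable w ->
  (\int[Q]_x (c + a * u x + b * w x) = c + a * \int[Q]_x u x + b * \int[Q]_x w x)%R.
Proof.
move=> bu bw; have bc := bounded_measurable_cst S c.
have bau := bounded_measurableM (bounded_measurable_cst S a) bu.
have bbw := bounded_measurableM (bounded_measurable_cst S b) bw.
by rewrite meanD ?meanD ?mean_cst ?meanZ//; exact: bounded_measurableD.
Qed.

End mean.

(** * Jensen's inequality for the Bregman divergence on a compact interval *)

Section bounded_subadditivity.
Context {R : realType}.
Variables (al be : R) (P0 P1 P2 : R -> R).
Let K : set R := `[al, be].
Hypothesis P0cont : {within K, continuous P0}.
Hypothesis P1cont : {within K, continuous P1}.
Hypothesis tangent : forall u w a b, K u -> K w -> K a -> K b ->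
  P0 a - P0 b - P1 b * (a - b) + (P1 a - P1 b) * (u - a) - P2 b * (a - b) * (w - b)
  <= bregman P0 P1 u w.

Lemma bounded_measurable_cont (d : measure_display) (S : measurableType d)
    (G : R -> R) (u : S -> R) : {within K, continuous G} ->
  measurable_fun setT u -> (forall x, K (u x)) -> bounded_measurable (fun x => G (u x)).
Proof.
move=> Gcont mu uK; split.
  have mK : measurable (K : set (measurableTypeR R)) by exact: measurable_itv.
  have mG : measurable_fun K G by exact: subspace_continuous_measurable_fun.
  apply: (measurable_comp mK _ mG mu).
  by move=> _ [x _ <-]; exact: uK.
have : compact (G @` K) by apply: continuous_compact => //; exact: segment_compact.
move=> /compact_bounded[M [_ GM]]; exists (M + 1) => x; apply: GM; first by rewrite ltrDl.
by exists (u x).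
Qed.

Section one_space.
Context (d : measure_display) (S : measurableType d).
Variable Q : probability S R.

Lemma bounded_measurable_bregman (u w : S -> R) :
  measurable_fun setT u -> (forall x, K (u x)) ->
  measurable_fun setT w -> (forall x, K (w x)) ->
  bounded_measurable (fun x => bregman P0 P1 (u x) (w x)).
Proof.
move=> mu uK mw wK; apply: bounded_measurableB.
  by apply: bounded_measurableB; exact: bounded_measurable_cont.
apply: bounded_measurableM; first exact: bounded_measurable_cont.
by apply: bounded_measurableB;
  [apply: bounded_measurable_itv mu uK|apply: bounded_measurable_itv mw wK].
Qed.

Lemma mean_K (u : S -> R) : measurable_fun setT u -> (forall x, K (u x)) ->
  K (\int[Q]_x u x).
Proof. by move=> mu uK; rewrite /K/= in_itv/=; apply: mean_itv. Qed.

(** The tangent plane at the point of means [(a, b)] is an affine minorant [c + p * u + q * w] of D;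
    its mean is its value at [(a, b)], where it touches D. *)
Lemma jensen_bregman (u w : S -> R) :
  measurable_fun setT u -> (forall x, K (u x)) ->
  measurable_fun setT w -> (forall x, K (w x)) ->
  bregman P0 P1 (\int[Q]_x u x) (\int[Q]_x w x) <=
  \int[Q]_x bregman P0 P1 (u x) (w x).
Proof.
move=> mu uK mw wK; set a := (\int[Q]_x u x)%R; set b := (\int[Q]_x w x)%R.
have bu : bounded_measurable u by exact: bounded_measurable_itv mu uK.
have bw : bounded_measurable w by exact: bounded_measurable_itv mw wK.
have Ka : K a by exact: mean_K.
have Kb : K b by exact: mean_K.
pose p := P1 a - P1 b; pose q := - (P2 b * (a - b)).
pose c := bregman P0 P1 a b - p * a - q * b.
have -> : bregman P0 P1 a b = \int[Q]_x (c + p * u x + q * w x).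
  by rewrite mean_affine// -/a -/b /c; ring.
apply: mean_le => [||x].
- by do ![exact: bounded_measurable_cst | exact: bu | exact: bw |
    apply: bounded_measurableD | apply: bounded_measurableM].
- exact: bounded_measurable_bregman.
- apply: le_trans (tangent (uK x) (wK x) Ka Kb).
  by rewrite /c /p /q /bregman; lra.
Qed.

(** For [c] the mean of [u], the last term vanishes and the entropy of [u] appears. For another [c],
    the right side exceeds the entropy by the divergence of the mean from [c]. *)
Lemma mean_bregman (u : S -> R) (c : R) :
  measurable_fun setT u -> (forall x, K (u x)) ->
  \int[Q]_x bregman P0 P1 (u x) c =
  \int[Q]_x P0 (u x) - P0 c - P1 c * (\int[Q]_x u x - c).
Proof.
move=> mu uK.
have bu : bounded_measurable u by exact: bounded_measurable_itv mu uK.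
have bP : bounded_measurable (fun x => P0 (u x)) by exact: bounded_measurable_cont.
rewrite (@eq_Rintegral _ _ _ _ _
  (fun x => (P1 c * c - P0 c) + 1 * P0 (u x) + (- P1 c) * u x)).
  by rewrite mean_affine//; ring.
by move=> x _; rewrite /bregman; ring.
Qed.

End one_space.
End bounded_subadditivity.

(* A product space is only used through the maps [r i x y], which replace the
   i-th coordinate of x by y. *)
Section resampling.
Context {R : realType} (dX : measure_display) (X : measurableType dX)
  (P : probability X R) (n : nat) (d : 'I_n -> measure_display)
  (T : forall i : 'I_n, measurableType (d i))
  (m : forall i : 'I_n, probability (T i) R)
  (r : forall i : 'I_n, X -> T i -> X).
Implicit Types (h : X -> R) (i j k : 'I_n).

Hypothesis measurable_r : forall i,
  measurable_fun setT (fun p : X * T i => r p.1 p.2).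
Hypothesis r_same : forall x i (y z : T i), r (r x y) z = r x z.
Hypothesis r_comm : forall x i j (y : T i) (z : T j), i != j ->
  r (r x y) z = r (r x z) y.
Hypothesis r_inv : forall i (B : set X), measurable B ->
  (P \x m i)%E ((fun p : X * T i => r p.1 p.2) @^-1` B) = P B.

Lemma measurable_r_section x i : measurable_fun setT (fun y : T i => r x y).
Proof.
exact: (measurableT_comp (@measurable_r i) (measurable_pair1 x)).
Qed.

Lemma ge0_integral_resample i (g : X -> \bar R) : measurable_fun setT g ->
  (forall x, 0 <= g x)%E ->
  (\int[P]_x \int[m i]_y g (r x y) = \int[P]_x g x)%E.
Proof.
move=> mg g0; pose phi (p : X * T i) := r p.1 p.2.
have mphi : measurable_fun setT phi := @measurable_r i.
rewrite -(@fubini_tonelli1 _ _ _ _ _ P (m i) (g \o phi))//; last first.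
- by move=> p /=; exact: g0.
- exact: measurableT_comp mg mphi.
pose mixin := isMeasurableFun.Build _ _ _ _ phi mphi.
pose phi' : {mfun _ >-> _} := HB.pack phi mixin.
transitivity (\int[pushforward (P \x m i)%E phi']_x g x)%E.
  by rewrite ge0_integral_pushforward.
by apply: eq_measure_integral => B mB _; exact: r_inv.
Qed.

(** By Tonelli and invariance of the law, [F x], the integral of [|h|] along the i-th section
    through [x], has a finite integral, so it is finite off a null set. *)
Lemma resample_integrable i h : P.-integrable setT (EFin \o h) ->
  exists Z, [/\ measurable Z, P Z = 0%E &
    forall x, ~ Z x -> (m i).-integrable setT (EFin \o (fun y : T i => h (r x y)))].
Proof.
move=> ih; have mh : measurable_fun setT h by exact/measurable_EFinP/(measurable_int P).
pose g (x : X) := `|(h x)%:E|%E.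
have mg : measurable_fun setT g by apply: measurableT_comp => //; exact/measurable_EFinP.
have g0 x : (0 <= g x)%E by exact: abse_ge0.
pose F x := (\int[m i]_y g (r x y))%E.
have mF : measurable_fun setT F.
  apply: (measurable_fun_fubini_tonelli_F (g \o (fun p : X * T i => r p.1 p.2))) => //=.
    exact: (measurableT_comp mg (@measurable_r i)).
have F0 x : (0 <= F x)%E by exact: integral_ge0.
have iF : P.-integrable setT F.
  apply/integrableP; split=> //.
  under eq_integral do rewrite gee0_abs//.
  by rewrite ge0_integral_resample//; have /integrableP[] := ih.
have [N [mN N0 FN]] := integrable_ae measurableT iF.
exists N; split => // x Nx; apply/integrableP; split.
  apply/measurable_EFinP.
  have := @measurableT_comp _ _ _ (T i) X R h setT (fun y => r x y) mh; apply.
  exact: measurable_r_section.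
have : F x \is a fin_num by apply: contrapT => Fx; apply: Nx; apply: FN => /(_ Logic.I).
by rewrite ge0_fin_numE.
Qed.

(** The operator E_i, that is, the conditional expectation given all coordinates except the i-th. *)
Definition avg i h (x : X) : R := (\int[m i]_y h (r x y))%R.

Lemma bounded_section i h x : bounded_measurable h ->
  bounded_measurable (fun y : T i => h (r x y)).
Proof. exact/bounded_measurable_comp/measurable_r_section. Qed.

Lemma integrable_resample i h : bounded_measurable h ->
  (P \x m i)%E.-integrable setT (EFin \o (fun p : X * T i => h (r p.1 p.2))).
Proof.
move=> bh.
apply: (@bounded_measurable_integrable R _ (X * T i)%type
  ((P \x m i)%E : probability (X * T i)%type R)).
exact: (bounded_measurable_comp (@measurable_r i)).
Qed.

Lemma measurable_avg i h : bounded_measurable h -> measurable_fun setT (avg i h).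
Proof.
move=> bh; have ih := integrable_resample i bh.
have := measurable_fubini_F ih.
exact: measurableT_comp.
Qed.

Lemma bounded_avg i h : bounded_measurable h -> bounded_measurable (avg i h).
Proof.
move=> bh; split; first exact: measurable_avg.
have [mh [M hM]] := bh; exists M => x.
rewrite ler_norml; apply: mean_itv => [|y].
  by have [] := bounded_section i x bh.
by rewrite -ler_norml.
Qed.

Lemma mean_avg i h : bounded_measurable h ->
  (\int[P]_x avg i h x = \int[P]_x h x)%R.
Proof.
move=> bh; pose phi (p : X * T i) := r p.1 p.2.
have mphi : measurable_fun setT phi := @measurable_r i.
pose mixin := isMeasurableFun.Build _ _ _ _ phi mphi.
pose phi' : {mfun _ >-> _} := HB.pack phi mixin.
have ih := integrable_resample i bh.
congr fine; transitivity (\int[P]_x \int[m i]_y (h (r x y))%:E)%E.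
  apply: eq_integral => x _; apply: EFin_Rintegral; exact: bounded_section.
rewrite (integral12_prod_meas1 ih).
transitivity (\int[pushforward (P \x m i)%E phi']_x (h x)%:E)%E.
  rewrite integral_pushforward//.
  by apply/measurable_EFinP; case: bh.
by apply: eq_measure_integral => B mB _; exact: r_inv.
Qed.

Lemma avg_same i h x (y : T i) : avg i h (r x y) = avg i h x.
Proof. by rewrite /avg; under eq_Rintegral do rewrite r_same. Qed.

Lemma avg_other i j h x (y : T j) : i != j ->
  (forall x (y : T j), h (r x y) = h x) -> avg i h (r x y) = avg i h x.
Proof.
move=> ij hj; rewrite /avg; apply: eq_Rintegral => z _.
by rewrite r_comm 1?eq_sym// hj.
Qed.

(** Fubini on [T i * T j], the two replacements themselves commuting by [r_comm]. *)
Lemma avg_comm i j h x : i != j -> bounded_measurable h ->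
  avg i (avg j h) x = avg j (avg i h) x.
Proof.
move=> ij bh.
pose phi (p : T i * T j) := r (r x p.1) p.2.
have mphi : measurable_fun setT phi.
  have := @measurableT_comp _ _ _ (T i * T j)%type (X * T j)%type X
    (fun p => r p.1 p.2) setT (fun p => (r x p.1, p.2)) (@measurable_r j).
  apply.
  apply/measurable_fun_pairP; split => /=.
    have := @measurableT_comp _ _ _ (T i * T j)%type (T i) X (fun y => r x y) setT fst.
    by apply => //; exact: measurable_r_section.
  exact: measurable_snd.
have ih : (m i \x m j)%E.-integrable setT (EFin \o (h \o phi)).
  apply: (@bounded_measurable_integrable R _ (T i * T j)%type
    ((m i \x m j)%E : probability (T i * T j)%type R)).
  exact: (bounded_measurable_comp mphi).
have := Fubini ih; rewrite /= /phi/= => fub.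
congr fine; transitivity (\int[m i]_y \int[m j]_z (h (r (r x y) z))%:E)%E.
  apply: eq_integral => y _; apply: EFin_Rintegral; exact: bounded_section.
rewrite fub; apply: eq_integral => z _.
rewrite EFin_Rintegral; last exact: bounded_section.
by apply: eq_integral => y _; rewrite r_comm.
Qed.

(** The last averaging removes the dependence on its own coordinate ([avg_same]) and preserves the
    invariance already gained in the others ([avg_other]). *)
Lemma avg_fold_invariant (s : seq 'I_n) h j x (y : T j) : j \in s ->
  foldl (fun g i => avg i g) h s (r x y) = foldl (fun g i => avg i g) h s x.
Proof.
elim/last_ind: s => // s i IH in x y *; rewrite mem_rcons inE foldl_rcons.
have [ji|ji /= js] := eqVneq j i; first by subst j => _; exact: avg_same.
by apply: avg_other => [|z w]; [rewrite eq_sym|exact: IH].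
Qed.

Hypothesis r_connected : forall h,
  (forall i x (y : T i), h (r x y) = h x) -> forall x x', h x = h x'.

Variables (al be : R) (P0 P1 P2 : R -> R).
Let K : set R := `[al, be].
Hypothesis P0cont : {within K, continuous P0}.
Hypothesis P1cont : {within K, continuous P1}.
Hypothesis tangent : forall u w a b, K u -> K w -> K a -> K b ->
  P0 a - P0 b - P1 b * (a - b) + (P1 a - P1 b) * (u - a) - P2 b * (a - b) * (w - b)
  <= bregman P0 P1 u w.

Let values h := measurable_fun setT h /\ (forall x, K (h x)).

Let values_bounded h : values h -> bounded_measurable h.
Proof. by move=> [mh hK]; exact: bounded_measurable_itv mh hK. Qed.

Let values_avg i h : values h -> values (avg i h).
Proof.
move=> vh; split; first exact/measurable_avg/values_bounded.
move=> x; apply: mean_K => [|y]; last by apply: vh.2.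
by have [] := bounded_section i x (values_bounded vh).
Qed.

Let bounded_P0 h : values h -> bounded_measurable (fun x => P0 (h x)).
Proof. by move=> [mh hK]; exact: (bounded_measurable_cont P0cont mh hK). Qed.

(** The real-valued counterpart of [coord_entropy], for functions with values in a compact
    interval. *)
Definition avg_entropy k h x := avg k (fun z => P0 (h z)) x - P0 (avg k h x).

Lemma bounded_avg_entropy k h : values h -> bounded_measurable (avg_entropy k h).
Proof.
move=> vh; apply: bounded_measurableB; first exact/bounded_avg/bounded_P0.
exact/bounded_P0/values_avg.
Qed.

(** The base point [avg k h z] is constant along the k-th coordinate. Keeping it under the outer
    average makes the integrand a function on all of [X], to which [avg_comm] applies. *)
Lemma avg_entropyE k h x : values h ->
  avg_entropy k h x = avg k (fun z => bregman P0 P1 (h z) (avg k h z)) x.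
Proof.
move=> vh; rewrite [RHS](@eq_Rintegral _ _ _ _ _
  (fun y => bregman P0 P1 (h (r x y)) (avg k h x))); last first.
  by move=> y _; rewrite avg_same.
have [msec _] := bounded_section k x (values_bounded vh).
rewrite (@mean_bregman _ al be P0 P1)//; last by move=> y; apply: vh.2.
by rewrite -/(avg k h x) subrr mulr0 subr0.
Qed.

Lemma avg_entropy_avg j k h x : j != k -> values h ->
  avg_entropy k (avg j h) x <= avg j (avg_entropy k h) x.
Proof.
move=> jk vh; have vj := values_avg j vh; have vk := values_avg k vh.
have vjk := values_avg j vk.
have bD : bounded_measurable (fun z => bregman P0 P1 (h z) (avg k h z)).
  exact: (bounded_measurable_bregman P0cont P1cont vh.1 vh.2 vk.1 vk.2).
rewrite avg_entropyE// (_ : avg_entropy k h =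
    avg k (fun z => bregman P0 P1 (h z) (avg k h z))); last first.
  by apply/funext => z; rewrite avg_entropyE.
rewrite avg_comm//; apply: mean_le.
- apply: (bounded_section k x
    (h := fun z => bregman P0 P1 (avg j h z) (avg k (avg j h) z))).
  have [mkj Kkj] := values_avg k vj.
  exact: (bounded_measurable_bregman P0cont P1cont vj.1 vj.2 mkj Kkj).
- by apply: bounded_section; exact: bounded_avg.
move=> y; move: (r x y) => z.
(* The outer averages have been exchanged above; exchanging also those in the base point makes both
   arguments of D means over the j-th coordinate, as Jensen's inequality requires. *)
rewrite avg_comm; [|by rewrite eq_sym|exact: values_bounded].
apply: (jensen_bregman P0cont P1cont tangent).
- by have [] := bounded_section j z (values_bounded vh).
- by move=> w; apply: vh.2.
- by have [] := bounded_section j z (values_bounded vk).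
- by move=> w; apply: vk.2.
Qed.

Lemma mean_avg_entropy k h : values h ->
  (\int[P]_x avg_entropy k h x =
   \int[P]_x P0 (h x) - \int[P]_x P0 (avg k h x))%R.
Proof.
move=> vh; rewrite meanB.
- by rewrite mean_avg//; exact: bounded_P0.
- exact/bounded_avg/bounded_P0.
- exact/bounded_P0/values_avg.
Qed.

Lemma telescope_avg_entropy (s : seq 'I_n) h : uniq s -> values h ->
  (\int[P]_x P0 (h x) - \int[P]_x P0 (foldl (fun g i => avg i g) h s x) <=
  \sum_(i <- s) \int[P]_x avg_entropy i h x)%R.
Proof.
elim: s h => [|i s IH] h /=; first by rewrite subrr big_nil.
move=> /andP[is_ us] vh; rewrite big_cons.
have := IH (avg i h) us (values_avg i vh).
have : (\sum_(j <- s) \int[P]_x avg_entropy j (avg i h) x <=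
        \sum_(j <- s) \int[P]_x avg_entropy j h x)%R.
  rewrite big_seq [leRHS]big_seq; apply: ler_sum => j js.
  (* The pointwise comparison is with [avg i] of the j-th entropy, which has the same mean as that
     entropy; [j] differs from [i] because the indices are distinct. *)
  rewrite -(mean_avg i (bounded_avg_entropy j vh)).
  apply: mean_le.
  - exact/bounded_avg_entropy/values_avg.
  - exact/bounded_avg/bounded_avg_entropy.
  - move=> x; apply: avg_entropy_avg => //.
    by apply: contraNneq is_ => ->.
rewrite mean_avg_entropy//; lra.
Qed.

Lemma bounded_subadditivity h : measurable_fun setT h -> (forall x, al <= h x <= be) ->
  (\int[P]_x P0 (h x) - P0 (\int[P]_x h x) <=
   \sum_(i < n) \int[P]_x avg_entropy i h x)%R.
Proof.
move=> mh hab; have vh : values h by split.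
have := telescope_avg_entropy (enum_uniq 'I_n) vh.
rewrite big_enum/=; apply: le_trans; rewrite lerD2l lerN2.
set g := foldl _ _ _.
have vg : values g.
  rewrite /g; elim: (enum _) h vh {mh hab g} => //= i s IH h vh.
  by apply: IH; exact: values_avg.
have gE : (\int[P]_x g x = \int[P]_x h x)%R.
  rewrite /g; elim: (enum _) h vh {mh hab g vg} => //= i s IH h vh.
  by rewrite IH ?mean_avg//; [exact: values_bounded|exact: values_avg].
(* Averaged over every coordinate, [g] is invariant under all replacements, hence constant; having
   the mean of [h], it equals that mean everywhere. *)
have gc x x' : g x = g x'.
  apply: r_connected => i z y; apply: avg_fold_invariant; exact: mem_enum.
have [x0 _] : [set: X] !=set0.
  apply/set0P/eqP => X0; have := probability_setT P; rewrite X0 measure0.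
  by move=> /eqP; rewrite eq_sym onee_eq0.
have g_x0 : g = cst (g x0) by apply/funext => x; exact: gc.
by rewrite -gE g_x0 /cst !mean_cst.
Qed.

End resampling.

(** * Truncation and passage to the limit *)

(* [e] need not be measurable: this disposes of the junk values of
   [coord_entropy] at the points with a non-integrable section. *)
Lemma le_integral_off_null (R : realType) (d : measure_display) (S : measurableType d)
    (mu : {measure set S -> \bar R}) (h e : S -> \bar R) (Z : set S) :
  measurable Z -> mu Z = 0%E -> measurable_fun setT h -> (forall x, 0 <= h x)%E ->
  (forall x, ~ Z x -> h x <= e x)%E -> (\int[mu]_x h x <= \int[mu]_x e x)%E.
Proof.
move=> mZ Z0 mh h0 he.
(* The integral of a non-negative function is a supremum over simple functions below it, so
   monotonicity requires no measurability. *)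
have ge0_mono (u w : S -> \bar R) : (forall x, 0 <= u x)%E -> (forall x, u x <= w x)%E ->
    (\int[mu]_x u x <= \int[mu]_x w x)%E.
  move=> u0 uw; have w0 x : (0 <= w x)%E by exact: le_trans (u0 x) (uw x).
  rewrite !ge0_integralTE//; apply: le_ereal_sup => _ [g gu <-]; exists g => // x.
  exact: le_trans (gu x) (uw x).
(* Off [Z] one has [e >= h >= 0], so the negative part of [e] is at most the function equal to +oo
   on [Z] and 0 elsewhere. *)
have eN0 : (\int[mu]_x e^\- x = 0)%E.
  apply/eqP; rewrite eq_le; apply/andP; split; last exact: integral_ge0.
  rewrite -(@null_set_integral _ _ _ mu Z (cst +oo%E))//.
  rewrite [leRHS]integral_mkcond; apply: ge0_mono => // x.
  rewrite patchE; case: ifPn => [_|]; first by rewrite leey.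
  rewrite notin_setE => Zx; rewrite funenegE ge_max lexx andbT oppe_le0.
  exact: le_trans (h0 x) (he x Zx).
rewrite [leRHS]integralE eN0 sube0.
rewrite -(setUv Z) ge0_integral_setU//=; last 3 first.
- exact: measurableC.
- by rewrite setUv.
- by apply/disj_set2P; rewrite setICr.
rewrite (@null_set_integral _ _ _ mu Z)//; last exact: measurable_funTS.
rewrite add0e integral_mkcond setUv; apply: ge0_mono => x; rewrite patchE.
  by case: ifP.
case: ifPn => [|_]; last exact: funepos_ge0.
by rewrite inE => /he/le_trans; apply; rewrite funeposE le_max lexx.
Qed.

Lemma Phi_entropy_cst (R : realType) (Phi : R -> R) (d : measure_display)
    (S : measurableType d) (Q : probability S R) (c : R) :
  Phi_entropy Phi Q (fun=> c) = 0%E.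
Proof.
rewrite /Phi_entropy -EFin_Rintegral; last exact: bounded_measurable_cst.
by rewrite !mean_cst subee.
Qed.

(** * Entropy and truncation on a single probability space *)

Section one_space_entropy.
Context {R : realType}.
Variables (I : set R) (Phi P1 : R -> R).
Let J := interior I.
Hypothesis Iitv : is_interval I.
Hypothesis Phicont : {within I, continuous Phi}.
Hypothesis dPhi : forall u, J u -> is_derive u 1 Phi (P1 u).
Hypothesis P1nd : forall u v, J u -> J v -> u <= v -> P1 u <= P1 v.

Context (d : measure_display) (S : measurableType d).
Variable Q : probability S R.

Lemma measurable_Phi (g : S -> R) : measurable_fun setT g -> (forall x, I (g x)) ->
  measurable_fun setT (fun x => Phi (g x)).
Proof.
move=> mg gI.
have mI : measurable (I : set (measurableTypeR R)) by exact: is_interval_measurable.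
have mPhi : measurable_fun I Phi by exact: subspace_continuous_measurable_fun.
apply: (measurable_comp mI _ mPhi mg).
by move=> _ [x _ <-]; exact: gI.
Qed.

(** The negative part of [f] is dominated by [|l|], so only the positive part can have an infinite
    integral. *)
Lemma integrable_or_pinfty (f l : S -> R) : measurable_fun setT f ->
  Q.-integrable setT (EFin \o l) -> (forall x, l x <= f x) ->
  Q.-integrable setT (EFin \o f) \/ (\int[Q]_x (f x)%:E = +oo)%E.
Proof.
move=> mf il lf.
have mEf : measurable_fun setT (EFin \o f) by exact/measurable_EFinP.
have iN : Q.-integrable setT ((EFin \o f)^\-)%E.
  apply: le_integrable il => //; first exact: measurable_funeneg.
  move=> x _; rewrite gee0_abs ?funeneg_ge0// funenegE/= -EFin_max lee_fin.
  rewrite ge_max normr_ge0 andbT.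
  by have := lf x; have := ler_norm (- l x); rewrite normrN; lra.
have [foo|foo] := ltP (\int[Q]_x (EFin \o f)^\+ x)%E +oo%E; [left|right].
  have iP : Q.-integrable setT ((EFin \o f)^\+)%E.
    apply/integrableP; split; first exact: measurable_funepos.
    by under eq_integral do rewrite gee0_abs ?funepos_ge0//.
  have := integrableB measurableT iP iN; apply: eq_integrable => // x _.
  exact: (congr1 (fun u => u x) (esym (funeposneg (EFin \o f)))).
rewrite integralE; move: foo; rewrite leye_eq => /eqP ->.
have := integrable_fin_num measurableT iN.
by case: (integral _ _ _).
Qed.

Lemma exists_ae (p : S -> Prop) : {ae Q, forall x, p x} -> exists x, p x.
Proof.
move=> [N [mN N0 pN]]; apply: contrapT => np.
have NT : N = setT by apply/seteqP; split => // x _; apply: pN => px; apply: np; exists x.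
have := probability_setT Q; rewrite -NT N0 => /eqP.
by rewrite eq_sym onee_eq0.
Qed.

Lemma ae_eq_mean (g : S -> R) (m := (\int[Q]_x g x)%R) :
  Q.-integrable setT (EFin \o g) ->
  (forall x, g x <= m) \/ (forall x, m <= g x) -> {ae Q, forall x, g x = m}.
Proof.
move=> ig gm.
have im : Q.-integrable setT (EFin \o (fun _ : S => m)).
  exact/bounded_measurable_integrable/bounded_measurable_cst.
have ib : Q.-integrable setT (EFin \o (fun x => g x - m)).
  by have := integrableB measurableT ig im; apply: eq_integrable => // x _.
have gE : (\int[Q]_x (g x - m))%R = 0 by rewrite RintegralB// mean_cst subrr.
have zero : (\int[Q]_x `|(g x - m)%:E| = 0)%E.
  have fin0 : (\int[Q]_x (g x - m)%:E = 0)%E.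
    by rewrite -[LHS]fineK ?[X in X%:E]gE//; exact: (integrable_fin_num measurableT ib).
  case: gm => gm.
    transitivity (\int[Q]_x (- (g x - m)%:E))%E.
      by apply: eq_integral => x _; rewrite lee0_abs// lee_fin subr_le0.
    by rewrite integralN ?fin0 ?oppe0//; exact: integrable_add_def.
  rewrite -fin0; apply: eq_integral => x _.
  by rewrite gee0_abs// lee_fin subr_ge0.
have mb : measurable_fun setT (fun x => (g x - m)%:E) by exact: (measurable_int Q ib).
have [/(_ zero)] := ae_eq_integral_abs Q measurableT mb.
move=> H _; apply: filterS H => x /(_ Logic.I) [] /eqP.
by rewrite subr_eq0 => /eqP.
Qed.

(** If [I] has points on both sides of [m], then [m] is interior. Otherwise [g] stays on one side of
    its mean, hence equals it almost everywhere, and [m] lies in [I] as a value of [g]. *)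
Lemma mean_interior (g : S -> R) (m := (\int[Q]_x g x)%R) :
  (forall x, I (g x)) -> Q.-integrable setT (EFin \o g) ->
  I m /\ (J m \/ {ae Q, forall x, g x = m}).
Proof.
move=> gI ig.
have [[x [y [Ix Iy xmy]]]|nb] := pselect (exists x y, [/\ I x, I y & x < m < y]).
  have Jm : J m by exact: interior_between Iitv Ix Iy xmy.
  by split; [exact: interior_subset|left].
have : {ae Q, forall x, g x = m}.
  apply: ae_eq_mean => //.
  have [[x [Ix xm]]|nx] := pselect (exists x, I x /\ x < m); [left|right] => z.
    by rewrite leNgt; apply/negP => mz; apply: nb; exists x, (g z); rewrite xm mz.
  by rewrite leNgt; apply/negP => zm; apply: nx; exists (g z).
move=> gm; split; last by right.
by have [x <-] := exists_ae gm.
Qed.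

Lemma Phi_entropy_ae_cst (g : S -> R) (c : R) : measurable_fun setT g ->
  (forall x, I (g x)) -> {ae Q, forall x, g x = c} -> Phi_entropy Phi Q g = 0%E.
Proof.
move=> mg gI gc; rewrite -(Phi_entropy_cst Phi Q c) /Phi_entropy.
congr (_ - (Phi _)%:E)%E.
  apply: ae_eq_integral => //; first exact/measurable_EFinP/measurable_Phi.
  by apply: filterS gc => x -> _.
congr fine; apply: ae_eq_integral => //; first exact/measurable_EFinP.
by apply: filterS gc => x -> _.
Qed.

Definition clamp (al be u : R) := Order.max (Order.min u be) al.

Lemma clamp_itv al be u : al <= be -> al <= clamp al be u <= be.
Proof.
by move=> ab; rewrite /clamp le_max lexx orbT/= ge_max ab andbT ge_min lexx orbT.
Qed.

Lemma clamp_normB al be c u : al <= c <= be -> `|clamp al be u - c| <= `|u - c|.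
Proof.
move=> /andP[ac cb]; rewrite /clamp.
have [ub|bu] := leP u be; [have [ua|au] := leP u al|have [ba|ab] := leP be al] => //.
- by rewrite !ler0_norm; lra.
- by rewrite !ger0_norm; lra.
- by rewrite !ger0_norm; lra.
Qed.

Lemma measurable_clamp al be (g : S -> R) : measurable_fun setT g ->
  measurable_fun setT (fun x => clamp al be (g x)).
Proof.
by move=> mg; apply: measurable_maxr => //; apply: measurable_minr.
Qed.

Section clamped.
Variables (al be : R).
Hypotheses (Jal : J al) (Jbe : J be) (ab : al <= be).

Lemma itv_interior u : al <= u <= be -> J u.
Proof. by move=> ?; apply: (is_interval_interior Iitv Jal Jbe). Qed.

Lemma Phi_cont_itv : {within `[al, be], continuous Phi}.
Proof.
apply: continuous_subspaceW Phicont => u /=; rewrite in_itv/= => /itv_interior.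
exact: interior_subset.
Qed.

Lemma Phi_entropy_itv (h : S -> R) : measurable_fun setT h ->
  (forall x, al <= h x <= be) ->
  Phi_entropy Phi Q h = (\int[Q]_x Phi (h x) - Phi (\int[Q]_x h x))%R%:E.
Proof.
move=> mh hab; rewrite /Phi_entropy -EFin_Rintegral//.
exact: (bounded_measurable_cont Phi_cont_itv).
Qed.

(** The mean is the best base point: for [c], the excess is the divergence of the mean from [c].
    This is what allows the clamped mean as base point, although clamping does not commute with
    means. *)
Lemma entropy_le_mean_bregman (h : S -> R) c : measurable_fun setT h ->
  (forall x, al <= h x <= be) -> J c ->
  \int[Q]_x Phi (h x) - Phi (\int[Q]_x h x) <= \int[Q]_x bregman Phi P1 (h x) c.
Proof.
move=> mh hab Jc; rewrite (mean_bregman P1 Phi_cont_itv)//.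
have Im : I (\int[Q]_x h x).
  by apply: interior_subset; apply: itv_interior; apply: mean_itv.
by have := bregman_ge0 Iitv Phicont dPhi P1nd Im Jc; rewrite /bregman; lra.
Qed.

Lemma entropy_itv_ge0 (h : S -> R) : measurable_fun setT h ->
  (forall x, al <= h x <= be) ->
  0 <= \int[Q]_x Phi (h x) - Phi (\int[Q]_x h x).
Proof.
move=> mh hab; have Jm : J (\int[Q]_x h x) by apply: itv_interior; exact: mean_itv.
have -> : \int[Q]_x Phi (h x) - Phi (\int[Q]_x h x) =
    \int[Q]_x bregman Phi P1 (h x) (\int[Q]_x h x).
  by rewrite (mean_bregman P1 Phi_cont_itv)// subrr mulr0 subr0.
apply: Rintegral_ge0 => x _; apply: (bregman_ge0 Iitv Phicont dPhi P1nd) => //.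
by apply: interior_subset; apply: itv_interior; exact: hab.
Qed.

Lemma integrable_bregman (g : S -> R) c : Q.-integrable setT (EFin \o g) ->
  Q.-integrable setT (EFin \o (fun x => Phi (g x))) ->
  Q.-integrable setT (EFin \o (fun x => bregman Phi P1 (g x) c)) /\
  (\int[Q]_x bregman Phi P1 (g x) c =
   \int[Q]_x Phi (g x) - Phi c - P1 c * (\int[Q]_x g x - c))%R.
Proof.
move=> ig iP; pose k := - Phi c + P1 c * c.
have ik : Q.-integrable setT (EFin \o (fun _ : S => k)).
  exact/bounded_measurable_integrable/bounded_measurable_cst.
have iZ : Q.-integrable setT (EFin \o (fun x => P1 c * g x)).
  by have := integrableZl measurableT (P1 c) ig; apply: eq_integrable.
have iPZ : Q.-integrable setT (EFin \o (fun x => Phi (g x) - P1 c * g x)).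
  by have := integrableB measurableT iP iZ; apply: eq_integrable.
have iA : Q.-integrable setT (EFin \o (fun x => Phi (g x) - P1 c * g x + k)).
  by have := integrableD measurableT iPZ ik; apply: eq_integrable.
have E : (fun x => bregman Phi P1 (g x) c) = (fun x => Phi (g x) - P1 c * g x + k).
  by apply/funext => x; rewrite /bregman /k; ring.
split; first by rewrite E.
by rewrite E RintegralD// RintegralB// RintegralZl// mean_cst /k; ring.
Qed.

(** The tangent to [Phi] at [c], composed with [g], is an integrable minorant. *)
Lemma Phi_integrable_or_pinfty (g : S -> R) c : J c -> measurable_fun setT g ->
  (forall x, I (g x)) -> Q.-integrable setT (EFin \o g) ->
  Q.-integrable setT (EFin \o (fun x => Phi (g x))) \/ (\int[Q]_x (Phi (g x))%:E = +oo)%E.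
Proof.
move=> Jc mg gI ig.
apply: (@integrable_or_pinfty _ (fun x => P1 c * g x + (Phi c - P1 c * c))).
- exact: measurable_Phi.
- have iZ : Q.-integrable setT (EFin \o (fun x => P1 c * g x)).
    by have := integrableZl measurableT (P1 c) ig; apply: eq_integrable.
  have ik : Q.-integrable setT (EFin \o (fun _ : S => Phi c - P1 c * c)).
    exact/bounded_measurable_integrable/bounded_measurable_cst.
  by have := integrableD measurableT iZ ik; apply: eq_integrable.
- move=> x; have := bregman_ge0 Iitv Phicont dPhi P1nd (gI x) Jc.
  by rewrite /bregman; lra.
Qed.

Lemma bregman_clamp u m : I u -> J m ->
  bregman Phi P1 (clamp al be u) (clamp al be m) <= bregman Phi P1 u m.
Proof.
move=> Iu Jm.
have Imin : I (Order.min u be) by case: leP => // _; exact: interior_subset.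
have Jmin : J (Order.min m be) by case: leP.
apply: le_trans (bregman_maxr Iitv Phicont dPhi P1nd Imin Jmin Jal) _.
exact: (bregman_minr Iitv Phicont dPhi P1nd).
Qed.

(** With [m] the mean of [g], the entropy of the clamped function is at most the mean of D(clamp g,
    clamp m), hence at most that of D(g, m), which is the entropy of [g]. Apart are the cases where
    [g] is almost everywhere constant (both entropies vanish) and where [Phi (g x)] has infinite
    integral. *)
Lemma Phi_entropy_clamp (g : S -> R) : measurable_fun setT g ->
  (forall x, I (g x)) -> Q.-integrable setT (EFin \o g) ->
  (Phi_entropy Phi Q (fun x => clamp al be (g x)) <= Phi_entropy Phi Q g)%E.
Proof.
move=> mg gI ig; have [Im [Jm|gm]] := mean_interior gI ig; last first.
  rewrite (Phi_entropy_ae_cst mg gI gm).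
  rewrite (@Phi_entropy_ae_cst _ (clamp al be (\int[Q]_x g x)))//.
  - exact: measurable_clamp.
  - by move=> x; apply: interior_subset; apply: itv_interior; exact: clamp_itv.
  - by apply: filterS gm => x ->.
set m := (\int[Q]_x g x)%R in Im Jm.
have cab x : al <= clamp al be (g x) <= be by exact: clamp_itv.
have mc : measurable_fun setT (fun x => clamp al be (g x)) by exact: measurable_clamp.
rewrite Phi_entropy_itv//.
have [iP|Poo] := Phi_integrable_or_pinfty Jm mg gI ig; last first.
  by rewrite /Phi_entropy Poo addye// leey.
have -> : Phi_entropy Phi Q g = (\int[Q]_x Phi (g x) - Phi m)%R%:E.
  by rewrite /Phi_entropy EFinB fineK//; exact: (integrable_fin_num measurableT iP).
rewrite lee_fin.
have Jm' : J (clamp al be m) by apply: itv_interior; exact: clamp_itv.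
apply: le_trans (entropy_le_mean_bregman mc cab Jm') _.
have [ib bE] := integrable_bregman m ig iP.
have -> : \int[Q]_x Phi (g x) - Phi m = \int[Q]_x bregman Phi P1 (g x) m.
  by rewrite bE -/m subrr mulr0 subr0.
apply: le_Rintegral => //; last by move=> x _; exact: bregman_clamp.
apply: bounded_measurable_integrable.
have bc : bounded_measurable (fun x => Phi (clamp al be (g x))).
  exact: (bounded_measurable_cont Phi_cont_itv).
apply: bounded_measurableB; first exact/bounded_measurableB/bounded_measurable_cst.
apply: bounded_measurableM; first exact: bounded_measurable_cst.
by apply: bounded_measurableB;
  [exact: bounded_measurable_itv mc cab|exact: bounded_measurable_cst].
Qed.

End clamped.
End one_space_entropy.

(** * Exhaustion of an interval by compact intervals contained in its interior *)

Section exhaustion.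
Context {R : realType}.
Implicit Types (A : set R) (c : R).

(** A point of [A] below [al N], together with one above [c], will put [al N] in the interior.
    Convergence is claimed also at a minimum of [A], where the truncation may never be exact. *)
Lemma lower_exhaustion A c : A c -> (exists2 x, A x & x < c) ->
  exists al : nat -> R, (forall N, al N <= c /\ exists2 x, A x & x < al N) /\
    forall u, A u -> Order.max u (al N) @[N --> \oo] --> u.
Proof.
move=> Ac [x0 Ax0 x0c]; have [lA|nlA] := pselect (has_lbound A).
  have infA : has_inf A by split => //; exists c.
  pose l := inf A; have lP x : A x -> l <= x by move=> ?; exact: ge_inf.
  have lc : l < c by exact: le_lt_trans (lP _ Ax0) x0c.
  (* As [harmonic N] is 1 / (N + 1), the sequence starts at [c] and decreases to the infimum without
     reaching it. *)
  exists (fun N => l + (c - l) * harmonic N); split=> [N|u Au].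
    have h0 : 0 < harmonic N :> R by exact: harmonic_gt0.
    have h1 : harmonic N <= 1 :> R by rewrite /harmonic/= invf_le1// ler1n.
    split; first by nra.
    have e0 : 0 < (c - l) * harmonic N by rewrite mulr_gt0// subr_gt0.
    by have [x Ax xl] := inf_adherent e0 infA; exists x.
  apply/cvgrPdist_le => e e0.
  have : l + (c - l) * harmonic N @[N --> \oo] --> l + (c - l) * 0.
    apply: cvgD; first exact: cvg_cst.
    apply: cvgM; [exact: cvg_cst|exact: cvg_harmonic].
  rewrite mulr0 addr0 => /cvgrPdist_le/(_ e e0); apply: filterS => N.
  have lu := lP _ Au; set z := l + _ => lz.
  have [zu|uz] := leP z u; first by rewrite subrr normr0 ltW.
  move: lz; rewrite !ler_norml; lra.
exists (fun N => x0 - N%:R); split=> [N|u Au].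
  split; first by rewrite (le_trans _ (ltW x0c))// gerBl.
  apply: contrapT => nx; apply: nlA; exists (x0 - N%:R) => x Ax.
  by rewrite leNgt; apply/negP => xN; apply: nx; exists x.
apply: cvg_near_cst; near=> N.
have N_gt : `|x0 - u| < N%:R by near: N; exact: nbhs_infty_gtr.
apply/max_idPl; have := ler_norm (x0 - u); lra.
Unshelve. all: by end_near. Qed.

Lemma upper_exhaustion A c : A c -> (exists2 x, A x & c < x) ->
  exists be : nat -> R, (forall N, c <= be N /\ exists2 x, A x & be N < x) /\
    forall u, A u -> Order.min u (be N) @[N --> \oo] --> u.
Proof.
move=> Ac [x Ax cx].
have [||al [alP alcvg]] := @lower_exhaustion (fun y => A (- y)) (- c).
- by rewrite opprK.
- by exists (- x); rewrite ?opprK// ltrN2.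
exists (fun N => - al N); split=> [N|u Au].
  have [aN [y Ay ya]] := alP N; split; first by rewrite lerNr.
  by exists (- y) => //; rewrite ltrN2.
rewrite (_ : (fun N => _) = (fun N => - Order.max (- u) (al N))); last first.
  by apply/funext => N; rewrite oppr_max opprK.
by rewrite -[X in _ --> X]opprK; apply: cvgN; apply: alcvg; rewrite opprK.
Qed.

(** Separating the upper and lower corrections reduces convergence of [clamp] to the two one-sided
    limits. *)
Lemma clampE (al be u : R) : al <= be ->
  clamp al be u = u + (Order.min u be - u) + (Order.max u al - u).
Proof.
move=> ab; rewrite /clamp; have [ub|bu] := leP u be; have [ua|au] := leP u al.
- by lra.
- by lra.
- by have [?|?] := leP be al; lra.
- by have [?|?] := leP be al; lra.
Qed.

Lemma clamp_exhaustion (I : set R) c : is_interval I -> interior I c ->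
  exists al be : nat -> R,
    (forall N, [/\ (interior I) (al N), (interior I) (be N) & al N <= c <= be N]) /\
    forall u, I u -> clamp (al N) (be N) u @[N --> \oo] --> u.
Proof.
move=> Iitv Jc; have Ic := interior_subset Jc.
have /nbhs_ballP[e /= e0 eI] := Jc.
have [|al [alP alcvg]] := @lower_exhaustion I c Ic.
  exists (c - e / 2); last by rewrite ltrBlDr ltrDl divr_gt0.
  by apply: eI; rewrite /ball/= opprB addrC subrK gtr0_norm; lra.
have [|be [beP becvg]] := @upper_exhaustion I c Ic.
  exists (c + e / 2); last by rewrite ltrDl divr_gt0.
  by apply: eI; rewrite /ball/= opprD addNKr normrN gtr0_norm; lra.
exists al, be; split=> [N|u Iu].
  have [ac [x Ix xa]] := alP N; have [cb [y Iy yb]] := beP N.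
  split; last by rewrite ac.
    by apply: (interior_between Iitv Ix Iy); rewrite xa; lra.
  by apply: (interior_between Iitv Ix Iy); rewrite yb andbT; lra.
have : u + (Order.min u (be N) - u) + (Order.max u (al N) - u) @[N --> \oo] -->
    u + (u - u) + (u - u).
  apply: cvgD; last by apply: cvgB; [exact: alcvg|exact: cvg_cst].
  by apply: cvgD; [exact: cvg_cst|apply: cvgB; [exact: becvg|exact: cvg_cst]].
rewrite subrr !addr0; apply: cvg_trans; apply: near_eq_cvg; apply: nearW => N.
apply/esym/clampE.
by have [ac _] := alP N; have [cb _] := beP N; exact: le_trans ac cb.
Qed.

End exhaustion.

Lemma within_continuous_seq (R : realType) (A : set R) (f : R -> R)
    (v : nat -> R) (l : R) :
  {within A, continuous f} -> A l -> (forall N, A (v N)) -> v N @[N --> \oo] --> l ->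
  f (v N) @[N --> \oo] --> f l.
Proof.
move=> /subspace_continuousP fA Al vA vl.
apply: (@cvg_comp _ _ _ v f _ (within A (nbhs l))) (fA l Al).
move=> B AB; have ABv : \forall N \near \oo, A (v N) -> B (v N) := vl _ AB.
by suff : \forall N \near \oo, B (v N) by []; apply: filterS ABv => N; apply.
Qed.

Lemma limn_einf_le (R : realType) (u : nat -> \bar R) (b : nat -> R) (l : R) :
  (forall N, (u N <= (b N)%:E)%E) -> b N @[N --> \oo] --> l -> (limn_einf u <= l%:E)%E.
Proof.
move=> ub bl; have blE : (b N)%:E @[N --> \oo] --> l%:E.
  by apply: cvg_EFin => //; exact: nearW.
rewrite limn_einf_lim -(cvg_lim _ blE)//; apply: lee_lim.
- exact: is_cvg_einfs.
- by apply/cvg_ex; exists l%:E.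
- apply: nearW => N; apply: le_trans (ub N); apply: ereal_inf_lbound.
  by exists N => /=.
Qed.

(** * Lower semicontinuity of the entropy along truncations *)

Section entropy_limit.
Context {R : realType}.
Variables (I : set R) (Phi P1 : R -> R).
Let J := interior I.
Hypothesis Iitv : is_interval I.
Hypothesis Phicont : {within I, continuous Phi}.
Hypothesis dPhi : forall u, J u -> is_derive u 1 Phi (P1 u).
Hypothesis P1nd : forall u v, J u -> J v -> u <= v -> P1 u <= P1 v.

Context (d : measure_display) (S : measurableType d).
Variable Q : probability S R.

Variables (c : R) (al be : nat -> R).
Hypothesis Jc : J c.
Hypothesis albe : forall N, [/\ J (al N), J (be N) & al N <= c <= be N].
Hypothesis clamp_cvg : forall u, I u -> clamp (al N) (be N) u @[N --> \oo] --> u.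

Let ab N : al N <= be N.
Proof. by have [_ _ /andP[ac cb]] := albe N; exact: le_trans ac cb. Qed.

Lemma mean_clamp_cvg (g : S -> R) : measurable_fun setT g ->
  (forall x, I (g x)) -> Q.-integrable setT (EFin \o g) ->
  \int[Q]_x clamp (al N) (be N) (g x) @[N --> \oo] --> \int[Q]_x g x.
Proof.
move=> mg gI ig; apply: fine_cvg.
(* Clamping does not increase the distance to [c]; the triangle inequality, used twice, then costs
   [|c|] twice. *)
have iabs : Q.-integrable setT (fun x => `|(g x)%:E| + (2 * `|c|)%:E)%E.
  apply: integrableD => //; first exact: integrable_abse.
  exact: (bounded_measurable_integrable Q (bounded_measurable_cst S (2 * `|c|))).
have [] := @dominated_convergence _ S R Q setT measurableT
  (fun N x => (clamp (al N) (be N) (g x))%:E) (EFin \o g) _ _ _ _ iabs _.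
- by move=> N; apply/measurable_EFinP; exact: measurable_clamp.
- exact/measurable_EFinP.
- by apply: aeW => x _; apply: cvg_EFin; [exact: nearW|exact: clamp_cvg].
- apply: aeW => x N _; rewrite /= lee_fin.
  have [_ _ acb] := albe N; have := clamp_normB (g x) acb.
  have := ler_normD (clamp (al N) (be N) (g x) - c) c; rewrite subrK.
  have := ler_normD (g x) (- c); rewrite normrN; lra.
- move=> _ _; rewrite fineK//; exact: (integrable_fin_num measurableT ig).
Qed.

Lemma Phi_entropy_le_limit (g : S -> R) (B : R) : measurable_fun setT g ->
  (forall x, I (g x)) -> Q.-integrable setT (EFin \o g) ->
  (forall N, \int[Q]_x Phi (clamp (al N) (be N) (g x)) -
             Phi (\int[Q]_x clamp (al N) (be N) (g x)) <= B) ->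
  (Phi_entropy Phi Q g <= B%:E)%E.
Proof.
move=> mg gI ig gB.
pose gN N x := clamp (al N) (be N) (g x).
have cab N x : al N <= gN N x <= be N by exact: clamp_itv.
have JgN N x : J (gN N x).
  by have [Ja Jb _] := albe N; apply: (itv_interior Iitv Ja Jb); exact: cab.
have IgN N x : I (gN N x) by apply: interior_subset; exact: JgN.
have mgN N : measurable_fun setT (gN N) by exact: measurable_clamp.
have [Im _] := mean_interior Iitv gI ig.
pose m := (\int[Q]_x g x)%R; pose mN N := (\int[Q]_x gN N x)%R.
have mNm : mN N @[N --> \oo] --> m by exact: mean_clamp_cvg.
have ImN N : I (mN N).
  have [Ja Jb _] := albe N.
  by apply: interior_subset; apply: (itv_interior Iitv Ja Jb); exact: mean_itv.
have PmNm : Phi (mN N) @[N --> \oo] --> Phi m by exact: within_continuous_seq.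
(* By [gB] and [mean_bregman], [b N] bounds the mean of D(gN N, c). It converges because [Phi] is
   continuous on [I], even if the mean [m] is an endpoint. *)
pose b N := B + Phi (mN N) - Phi c - P1 c * (mN N - c).
have bcvg : b N @[N --> \oo] --> B + Phi m - Phi c - P1 c * (m - c).
  apply: cvgB.
    by apply: cvgB; [apply: cvgD => //; exact: cvg_cst|exact: cvg_cst].
  apply: cvgM; first exact: cvg_cst.
  by apply: cvgB => //; exact: cvg_cst.
pose D := bregman Phi P1.
have mD (h : S -> R) : measurable_fun setT h -> (forall x, I (h x)) ->
    measurable_fun setT (fun x => D (h x) c).
  move=> mh hI; apply: measurable_funB.
    by apply: measurable_funB => //; exact: (measurable_Phi Iitv).
  by apply: measurable_funM => //; exact: measurable_funB.
have D0 u : I u -> 0 <= D u c by move=> Iu; exact: (bregman_ge0 Iitv Phicont dPhi P1nd).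
have fatouD : (\int[Q]_x (D (g x) c)%:E <= (B + Phi m - Phi c - P1 c * (m - c))%:E)%E.
  have -> : (\int[Q]_x (D (g x) c)%:E =
      \int[Q]_x limn_einf (fun N => (D (gN N x) c)%:E))%E.
    apply: eq_integral => x _; apply/esym.
    have Dcvg : (D (gN N x) c)%:E @[N --> \oo] --> (D (g x) c)%:E.
      apply: cvg_EFin; first exact: nearW.
      have gNx : gN N x @[N --> \oo] --> g x by exact: clamp_cvg.
      apply: cvgB.
        by apply: cvgB; [exact: within_continuous_seq gNx|exact: cvg_cst].
      apply: cvgM; first exact: cvg_cst.
      by apply: cvgB => //; exact: cvg_cst.
    by have [] := cvg_limn_einf_sup Dcvg.
  apply: le_trans (fatou _ _ _ _) _ => //.
  - by move=> N; apply/measurable_EFinP; exact: mD.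
  - by move=> N x _; rewrite lee_fin; exact: D0.
  apply: limn_einf_le bcvg => N; have [Ja Jb _] := albe N.
  have cont := Phi_cont_itv Iitv Phicont Ja Jb.
  have -> : (\int[Q]_x (D (gN N x) c)%:E)%E = (\int[Q]_x D (gN N x) c)%:E.
    rewrite -EFin_Rintegral//.
    have bP : bounded_measurable (fun x => Phi (gN N x)).
      exact: (bounded_measurable_cont cont (mgN N) (cab N)).
    apply: bounded_measurableB; first exact/bounded_measurableB/bounded_measurable_cst.
    apply: bounded_measurableM; first exact: bounded_measurable_cst.
    by apply: bounded_measurableB;
      [exact: (bounded_measurable_itv (mgN N) (cab N))|exact: bounded_measurable_cst].
  rewrite lee_fin (mean_bregman P1 cont Q c (mgN N) (cab N)) -/(mN N) /b.
  by have := gB N; rewrite -/(mN N) /gN; lra.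
(* Fatou's bound is finite, so D(g, c) is integrable; adding back the tangent at [c] gives the
   integrability of [Phi (g x)], and the same affine change turns the bound into one on the
   entropy. *)
have iP : Q.-integrable setT (EFin \o (fun x => Phi (g x))).
  have iD : Q.-integrable setT (EFin \o (fun x => D (g x) c)).
    apply/integrableP; split; first exact/measurable_EFinP/mD.
    apply: le_lt_trans (ltry (B + Phi m - Phi c - P1 c * (m - c))).
    apply: le_trans fatouD; rewrite le_eqVlt; apply/orP; left; apply/eqP.
    by apply: eq_integral => x _; rewrite /= ger0_norm// D0.
  have iZ : Q.-integrable setT (EFin \o (fun x => P1 c * g x)).
    by have := integrableZl measurableT (P1 c) ig; apply: eq_integrable.
  have ik : Q.-integrable setT (EFin \o (fun _ : S => Phi c - P1 c * c)).
    exact/bounded_measurable_integrable/bounded_measurable_cst.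
  have := integrableD measurableT iD (integrableD measurableT iZ ik).
  apply: eq_integrable => // x _; rewrite /= -!EFinD; congr EFin.
  by rewrite /D /bregman; ring.
have [iD DE] := integrable_bregman P1 c ig iP.
move: fatouD; rewrite -[X in (X <= _)%E]fineK; last first.
  exact: (integrable_fin_num measurableT iD).
rewrite -/(Rintegral Q setT (fun x => D (g x) c)) DE lee_fin -/m => DB.
have -> : Phi_entropy Phi Q g = (\int[Q]_x Phi (g x) - Phi m)%R%:E.
  by rewrite /Phi_entropy EFinB fineK//; exact: (integrable_fin_num measurableT iP).
by rewrite lee_fin; lra.
Qed.

End entropy_limit.

Lemma smooth_is_derive (R : realType) (I : set R) (Phi : R -> R) (k : nat) (u : R) :
  smooth_on I Phi -> (interior I) u ->
  is_derive u 1 (derive1n k Phi) (derive1n k.+1 Phi u).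
Proof.
move=> [_ dPhi] Ju; have := derivableP (dPhi k u Ju).
by rewrite -derive1E -derive1nS.
Qed.

Lemma smooth_convex_nondecreasing (R : realType) (I : set R) (Phi : R -> R) (u v : R) :
  is_interval I -> smooth_on I Phi -> second_derivative_condition I Phi ->
  (interior I) u -> (interior I) v -> u <= v -> derive1n 1 Phi u <= derive1n 1 Phi v.
Proof.
move=> Iitv sPhi cPhi Ju Jv uv.
have Juv t : u <= t <= v -> (interior I) t by exact: (is_interval_interior Iitv Ju Jv).
have [||t] := @MVT_segment R (derive1n 1 Phi) (derive1n 2 Phi) u v uv.
- move=> t; rewrite in_itv/= => /andP[ut tv].
  by apply: (smooth_is_derive 1 sPhi); apply: Juv; rewrite !ltW.
- apply: derivable_within_continuous => t; rewrite in_itv/= => /Juv Jt.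
  exact: (sPhi.2 1%N t Jt).
rewrite in_itv/= => /Juv Jt P1E; rewrite -subr_ge0 P1E mulr_ge0 ?subr_ge0//.
(* For [x = 0] and [r = 1], the Hessian form of F is twice the second derivative of [Phi]. *)
have := @hessian_ge0 R (interior I) (derive1n 2 Phi) (derive1n 3 Phi) (derive1n 4 Phi)
  (@open_interior _ I) (fun u => smooth_is_derive 2 sPhi)
  (fun u => smooth_is_derive 3 sPhi) (condition_midconvex cPhi) t 0 1 Jt.
rewrite -[X in _ -> 0 <= X]/(derive1n 2 Phi t).
by move: (derive1n 4 Phi t) (derive1n 3 Phi t) (derive1n 2 Phi t) => p4 p3 p2; lra.
Qed.

Unset Implicit Arguments.
Set Strict Implicit.

Theorem proposition12 (R : realType) (I : set R) (Phi : R -> R)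
    (n : nat) (d : 'I_n -> measure_display)
    (T : forall i : 'I_n, measurableType (d i))
    (mu_ : forall i : 'I_n, probability (T i) R)
    (mu : probability (prod_space T) R) (f : prod_space T -> R) :
  is_interval I -> closed I ->
  smooth_on I Phi -> @convex_function R R^o I Phi ->
  second_derivative_condition I Phi ->
  is_product_measure mu_ mu ->
  measurable_fun [set: prod_space T] f -> (forall x, I (f x)) ->
  mu.-integrable [set: prod_space T] (EFin \o f) ->
  (Phi_entropy Phi mu f <=
   \sum_(i < n) \int[mu]_x coord_entropy Phi mu_ f i x)%E.
Proof.
move=> Iitv _ sPhi _ cPhi prod_mu mf fI intf.
have Phicont := sPhi.1; pose J := interior I.
have dP k u : J u -> is_derive u 1 (derive1n k Phi) (derive1n k.+1 Phi u).
  exact: smooth_is_derive.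
have P1nd u v : J u -> J v -> u <= v -> derive1n 1 Phi u <= derive1n 1 Phi v.
  exact: smooth_convex_nondecreasing.
(* If [I] has empty interior, two distinct values of [f] would have an interior midpoint; so [f] is
   constant and both sides vanish. *)
have [[c Jc]|J0] := pselect (exists c, J c); last first.
  have f_le x x' : f x <= f x'.
    rewrite leNgt; apply/negP => lt_f; apply: J0; exists ((f x' + f x) / 2).
    by apply: (interior_between Iitv (fI x') (fI x)); rewrite !midf_lt.
  have fE x x' : f x = f x' by apply/eqP; rewrite eq_le !f_le.
  have [x0 _] := @exists_ae _ _ _ mu (fun=> True) (aeW _ (fun _ => Logic.I)).
  have f_cst : f = cst (f x0) by apply/funext => x; exact: fE.
  rewrite f_cst Phi_entropy_cst big1// => i _; rewrite integral0_eq// => x _.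
  exact: Phi_entropy_cst.
have [al [be [albe clamp_cvg]]] := clamp_exhaustion Iitv Jc.
pose r i (x : prod_space T) (y : T i) := replace x y.
have mr i : measurable_fun setT (fun p : prod_space T * T i => r i p.1 p.2).
  exact: measurable_replace.
pose fN N x := clamp (al N) (be N) (f x).
have ab N : al N <= be N.
  by have [_ _ /andP[ac cb]] := albe N; exact: le_trans ac cb.
have mfN N : measurable_fun setT (fN N) by exact: measurable_clamp.
have fNab N x : al N <= fN N x <= be N by exact: clamp_itv.
pose cont N := Phi_cont_itv Iitv Phicont (let: And3 Ja _ _ := albe N in Ja)
  (let: And3 _ Jb _ := albe N in Jb).
have KJ N u : `[al N, be N]%classic u -> J u.
  have [Ja Jb _] := albe N.
  by rewrite /= in_itv/=; exact: (itv_interior Iitv Ja Jb).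
have tangent N u w a b := fun Ku Kw Ka Kb => @bregman_tangent R J Phi
  (derive1n 1 Phi) (derive1n 2 Phi) (derive1n 3 Phi) (derive1n 4 Phi)
  (@open_interior _ I) (is_interval_interior Iitv) (dP 0) (dP 1) (dP 2) (dP 3)
  (condition_midconvex cPhi) u w a b (KJ N u Ku) (KJ N w Kw) (KJ N a Ka) (KJ N b Kb).
have P1cont N : {within `[al N, be N], continuous (derive1n 1 Phi)}.
  apply: derivable_within_continuous => t tab.
  exact: (sPhi.2 1%N t (KJ N t tab)).
have inv i (B : set (prod_space T)) : measurable B ->
    (mu \x mu_ i)%E ((fun p : prod_space T * T i => r i p.1 p.2) @^-1` B) = mu B.
  exact: pushforward_replace.
(* Sections of the truncation are truncations of sections, so [Phi_entropy_clamp] applies wherever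
   the section of [f] is integrable, that is, off the null set [Z]. *)
have coord N i : ((\int[mu]_x avg_entropy mu_ r Phi i (fN N) x)%R%:E <=
    \int[mu]_x coord_entropy Phi mu_ f i x)%E.
  have [Z [mZ Z0 iZ]] := resample_integrable mr inv i intf.
  rewrite EFin_Rintegral; last first.
    exact: (bounded_avg_entropy mu mu_ mr (cont N) i
      (conj (mfN N) (fNab N))).
  apply: (le_integral_off_null mZ Z0).
  - apply/measurable_EFinP.
    by have [] := bounded_avg_entropy mu mu_ mr (cont N) i (conj (mfN N) (fNab N)).
  - move=> x; rewrite lee_fin; have [Ja Jb _] := albe N.
    apply: (entropy_itv_ge0 Iitv Phicont (dP 0) P1nd (mu_ i) Ja Jb) => //.
    have := @measurableT_comp _ _ _ _ _ _ (fN N) setT (fun y : T i => r i x y) (mfN N).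
    by apply; exact: (measurable_r_section mr x).
  - move=> x /iZ isec; have [Ja Jb _] := albe N.
    have msec : measurable_fun setT (fun y : T i => f (r i x y)).
      exact/measurable_EFinP/(measurable_int _ isec).
    have := Phi_entropy_clamp Iitv Phicont (dP 0) P1nd Ja Jb (ab N) msec _ isec.
    rewrite (Phi_entropy_itv Iitv Phicont (mu_ i) Ja Jb (measurable_clamp _ _ msec)).
      by apply => y; exact: fI.
    by move=> y; exact: fNab.
have entropy_fN N : \int[mu]_x Phi (fN N x) - Phi (\int[mu]_x fN N x) <=
    \sum_(i < n) \int[mu]_x avg_entropy mu_ r Phi i (fN N) x.
  apply: (bounded_subadditivity mr (@replace_same n d T)
    (@replace_comm n d T) inv (@replace_connected n d T R)
    (cont N) (P1cont N) (tangent N)) => //.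
have entropy_le N : ((\int[mu]_x Phi (fN N x) - Phi (\int[mu]_x fN N x))%R%:E <=
    \sum_(i < n) \int[mu]_x coord_entropy Phi mu_ f i x)%E.
  apply: (@le_trans _ _
    (\sum_(i < n) (\int[mu]_x avg_entropy mu_ r Phi i (fN N) x)%R%:E)%E).
    by rewrite sumEFin lee_fin.
  by apply: lee_sum => i _; exact: coord.
(* A finite sum is a bound uniform in [N], ready for the limit; +oo is trivial, and -oo cannot be an
   upper bound of a real number, already at [N = 0]. *)
move: entropy_le; case: (\sum_(i < n) _)%E => [B|_|/(_ 0%N)].
- move=> entropy_le.
  apply: (Phi_entropy_le_limit Iitv Phicont (dP 0) P1nd Jc albe clamp_cvg) => //.
- by rewrite leey.
- by rewrite leeNy_eq.
Qed.
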